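(* Let $k=6$. The IMEX-BDF6 scheme defined by $$\boldsymbol{A}^{(6)}=\left[\tfrac{49}{20},-6,\tfrac{15}{2},-\tfrac{20}{3},\tfrac{15}{4},-\tfrac65,\tfrac16\right]^\top,\quad \boldsymbol{B}^{(6)}=[1,0,0,0,0,0,0]^\top,\quad \hat{\boldsymbol{B}}^{(6)}=[6,-15,20,-15,6,-1]^\top$$ together with the multiplier coefficient vector $\boldsymbol{\mu}=\frac16[8,-2,-1,3,-3,1]^\top$ satisfies the feasibility conditions (FP) of the context with $\alpha=1/6$ and $\beta=1/6$. Hence the scheme admits modified energy dissipation: for the gradient flow in the setting of the context, $E_G^{n+1}\le E_G^n$ (for $k-1\le n\le N-1$) whenever $0<\tau\le\tau_{\max}$. The corresponding positive definite matrices $G_a,G_B$ in the modified energy $E_G^n$ satisfy the positive-definiteness conditions (PDC) of the context (with these $\alpha,\beta$) and are given by $$G_a=\frac1{100}\begin{bmatrix}286&-273&229&-125&17\\-273&354&-279&146&-27\\229&-279&260&-136&25\\-125&146&-136&87&-15\\17&-27&25&-15&12\end{bmatrix},\qquad G_B=\frac1{12}\begin{bmatrix}13&-6&0&4&-5&2\\-6&7&-4&0&2&-1\\0&-4&6&-4&1&0\\4&0&-4&6&-4&1\\-5&2&1&-4&5&-2\\2&-1&0&1&-2&1\end{bmatrix}.$$ In particular, the constant $\hat c_0$ appearing in $\tau_{\max}$ equals $625/3$.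
   Context: Abstract setting. $\Omega=(-\pi,\pi)^d$, $d\in\{1,2,3\}$, with periodic boundary conditions; $(v,w)=\int_\Omega vw\,\mathrm{d}\boldsymbol{x}$, $\|v\|=(v,v)^{1/2}$. $H$ is a Hilbert space with inner product $(\cdot,\cdot)$ and norm $\|\cdot\|$; $S,V$ are Hilbert spaces with $S\hookrightarrow V\hookrightarrow H$ (continuous and compact embeddings); $V'$ is the dual of $V$ and $V\subset H\subset V'$ is a Gelfand triple with duality pairing $\langle\cdot,\cdot\rangle_{V',V}$. $\mathcal{L}:S\to V$ is linear with $(\mathcal{L}u,v)=(u,\mathcal{L}v)$ and $(\mathcal{L}v,v)\ge 0$ for $u,v\in S$; $\|\mathcal{L}^{1/2}u\|:=(\mathcal{L}u,u)^{1/2}$. $\mathcal{M}:V\to V'$ is linear and self-adjoint, $\langle\mathcal{M}u,v\rangle_{V',V}=\langle\mathcal{M}v,u\rangle_{V',V}$, and there are constants $C_{\mathcal M},c_{\mathcal M}>0$ with $|\langle\mathcal{M}u,v\rangle_{V',V}|\le C_{\mathcal M}\|u\|_V\|v\|_V$ and $-\langle\mathcal{M}v,v\rangle_{V',V}\ge c_{\mathcal M}\|v\|_V^2$ for all $u,v\in V$; hence $\mathcal{M}^{-1}:V'\to V$ is bounded, self-adjoint and negative definite. For $v\in H$, $\|(-\mathcal{M})^{-1/2}v\|:=(v,-\mathcal{M}^{-1}v)^{1/2}$. There exist constants $\zeta>0$ and $0<\eta\le 1$ with $\|v\|\le\zeta\|(-\mathcal{M})^{-1/2}v\|^{\eta}\|\mathcal{L}^{1/2}v\|^{1-\eta}$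 for all $v\in S$. Nonlinearity. $f(u)=F'(u)$ for a potential $F$, with $(F(u),1):=\int_\Omega F(u)\,\mathrm{d}\boldsymbol{x}\ge 0$. $f:S\to V$ is globally Lipschitz: $\|f(u)-f(v)\|\le\ell_f\|u-v\|$ for all $u,v\in S$ ($\ell_f>0$), and (as a consequence) $|(F(u)-F(v),1)-(f(v),u-v)|\le\frac{\ell_f}{2}\|u-v\|^2$ for all $u,v\in S$. Gradient flow: $u_t=\mathcal{M}[\mathcal{L}u+f(u)]$, $u(0)=u^0$, on $(0,T]$. Scheme. Let $\tau=T/N$, $t_n=n\tau$. Given $u^0,\ldots,u^{k-1}\in S$, the $k$-step IMEX-LMM with coefficient vectors $\boldsymbol{A}^{(k)}=[A_0^{(k)},\ldots,A_k^{(k)}]^\top$, $\boldsymbol{B}^{(k)}=[B_0^{(k)},\ldots,B_k^{(k)}]^\top$, $\hat{\boldsymbol{B}}^{(k)}=[\hat B_1^{(k)},\ldots,\hat B_k^{(k)}]^\top$ is, for $k-1\le n\le N-1$ (with solution $u^{n+1}\in S$), $$\sum_{i=0}^kA_i^{(k)}u^{n+1-i}=\tau\mathcal{M}\Big[\sum_{i=0}^kB_i^{(k)}\mathcal{L}u^{n+1-i}+\sum_{i=1}^k\hat B_i^{(k)}f(u^{n+1-i})\Big].$$ The coefficients satisfy the order conditions $\sum_{i=0}^kA_i^{(k)}=0$ and, for $0\le m\le k-1$, $\sum_{i=0}^kA_i^{(k)}(-i)^{m+1}=(m+1)\sum_{i=0}^kB_i^{(k)}(-i)^m=(m+1)\sum_{i=1}^k\hat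 B_i^{(k)}(-i)^m$, and the normalization $\sum_{i=0}^kA_i^{(k)}(-i)=\sum_{i=0}^kB_i^{(k)}=\sum_{i=1}^k\hat B_i^{(k)}=1$; given $\boldsymbol{B}^{(k)}$, the order conditions determine $\boldsymbol{A}^{(k)}$ and $\hat{\boldsymbol{B}}^{(k)}$ uniquely. Convention: $0^0=1$ throughout. Put $\delta u^j=u^j-u^{j-1}$, $a_i^{(k)}=\sum_{j=0}^iA_j^{(k)}$ ($0\le i\le k-1$), $\hat b_i^{(k)}=\sum_{j=1}^i\hat B_j^{(k)}-1$ ($1\le i\le k-1$), $\boldsymbol{a}^{(k)}=[a_0^{(k)},\ldots,a_{k-1}^{(k)}]^\top$. Multiplier. For $\boldsymbol{\mu}=[\mu_0,\ldots,\mu_{k-1}]^\top$, let $\boldsymbol{\nu}=[\nu_0,\ldots,\nu_k]^\top$ with $\nu_0=\mu_0$, $\nu_k=-\mu_{k-1}$, $\nu_i=\mu_i-\mu_{i-1}$ ($1\le i\le k-1$). Generating polynomial: for $\boldsymbol{s}=[s_0,\ldots,s_r]^\top$, $M(z;\boldsymbol{s})=\sum_{i=0}^rs_iz^{r-i}$. Feasibility conditions (FP) for $(\boldsymbol{B}^{(k)},\boldsymbol{\mu},\alpha,\beta)$ with $\alpha,\beta>0$: $\sum_{i=0}^kB_i^{(k)}=1$, $\sum_{i=0}^{k-1}\mu_i=1$, and (a) $\deg M(z;\boldsymbol{a}^{(k)})=\deg M(z;\boldsymbol{\mu})=k-1$, $\deg M(z;\boldsymbol{B}^{(k)})=k$;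 (b) all roots of $M(z;\boldsymbol{\mu})$ lie in the open unit disk; (c) $M(z;\boldsymbol{a}^{(k)})$ and $M(z;\boldsymbol{\mu})$ are coprime, and $M(z;\boldsymbol{B}^{(k)})$ and $M(z;\boldsymbol{\nu})$ are coprime; (d) $P_a(x)\ge\alpha$ and $P_B(x)\ge\beta$ for all $x\in[-1,1]$, where $P_a,P_B$ are the polynomials in $x$ determined by $$P_a(\cos\theta)=\operatorname{Re}\{M(\mathrm{e}^{\mathrm{i}\theta};\boldsymbol{a}^{(k)})M(\mathrm{e}^{-\mathrm{i}\theta};\boldsymbol{\mu})\}\ (\theta\in[0,\pi]),\quad P_B(\cos\theta)=\frac{\operatorname{Re}\{M(\mathrm{e}^{\mathrm{i}\theta};\boldsymbol{B}^{(k)})M(\mathrm{e}^{-\mathrm{i}\theta};\boldsymbol{\nu})\}}{2(1-\cos\theta)}\ (\theta\in(0,\pi]),$$ $P_B$ being continuously extended to $x=1$. Positive-definiteness conditions (PDC): for all $\boldsymbol{x}\in\mathbb{R}^k$, $\boldsymbol{y}\in\mathbb{R}^{k+1}$, $\boldsymbol{x}^\top U_a\boldsymbol{x}\ge\alpha x_1^2$ and $\boldsymbol{y}^\top U_B\boldsymbol{y}\ge\beta(y_1-y_2)^2$, where ($\boldsymbol{0}_m$ the zero vector in $\mathbb{R}^m$) $$U_a=\tfrac12\big(\boldsymbol{\mu}(\boldsymbol{a}^{(k)})^\top+\boldsymbol{a}^{(k)}\boldsymbol{\mu}^\top\big)-\begin{bmatrix}G_a&\boldsymbol{0}_{k-1}\\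 \boldsymbol{0}_{k-1}^\top&0\end{bmatrix}+\begin{bmatrix}0&\boldsymbol{0}_{k-1}^\top\\ \boldsymbol{0}_{k-1}&G_a\end{bmatrix},$$ $$U_B=\tfrac12\big(\boldsymbol{\nu}(\boldsymbol{B}^{(k)})^\top+\boldsymbol{B}^{(k)}\boldsymbol{\nu}^\top\big)-\begin{bmatrix}G_B&\boldsymbol{0}_{k}\\ \boldsymbol{0}_{k}^\top&0\end{bmatrix}+\begin{bmatrix}0&\boldsymbol{0}_{k}^\top\\ \boldsymbol{0}_{k}&G_B\end{bmatrix}.$$ Modified energy. For vectors of functions and a matrix $G=(g_{ij})$, $(\boldsymbol{w},\boldsymbol{v})_G=\sum_{i,j}g_{ij}(w^i,v^j)$; linear operators act componentwise. With $\boldsymbol{v}_n=[\delta u^n,\ldots,\delta u^{n+2-k}]^\top$, $\boldsymbol{u}_n=[u^n,\ldots,u^{n+1-k}]^\top$, $$E_G^n=-\frac1\tau(\boldsymbol{v}_n,\mathcal{M}^{-1}\boldsymbol{v}_n)_{G_a}+(\boldsymbol{u}_n,\mathcal{L}\boldsymbol{u}_n)_{G_B}+\sum_{i=0}^{k-1}\mu_i(F(u^{n-i}),1)+\frac{\ell_f}{2}\sum_{i=1}^{k-1}\hat c_i\|\delta u^{n+1-i}\|^2,$$ where $\hat c_i=\sum_{j=i}^{k-1}\tilde c_j$ ($0\le i\le k-1$) and, with $\delta_{i,0}$ the Kronecker delta, $$\tilde c_i=(1-\delta_{i,0})|\hat b_i^{(k)}|\sum_{j=0}^{k-1}|\mu_j|+|\mu_i|\sum_{j=1}^{k-1}|\hat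 b_j^{(k)}|+|\mu_i|+\Big(|\mu_i|+\sum_{j=i}^{k-1}j|\mu_j|\Big)(1-\delta_{i,0}).$$ Time-step bound: with $\bar\eta=\frac{1-\eta}{\eta}$, $$\tau_{\max}=\frac{\alpha\beta^{\bar\eta}}{(\ell_f\hat c_0/2)^{1+\bar\eta}\,\eta\,(1-\eta)^{\bar\eta}\,\zeta^{2+2\bar\eta}}.$$ *)

(* Defs.v *)
From HB Require Import structures.
From mathcomp Require Import all_boot all_order all_algebra.
From mathcomp Require Import sesquilinear.
From mathcomp Require Import all_classical all_reals all_analysis.
From mathcomp Require Import complex.

Set Implicit Arguments.
Unset Strict Implicit.
Unset Printing Implicit Defensive.

Import Order.TTheory GRing.Theory Num.Theory.
Import numFieldNormedType.Exports.

Local Open Scope classical_set_scope.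
Local Open Scope ring_scope.

(* A k-step scheme has k = p.+1.  Coefficient vectors are tuples, read through
   s`_i (which is 0 beyond the end of s).  Bh holds the coefficients with
   indices 1, ..., k, so the coefficient of index i is Bh`_i.-1. *)
Section Coefficients.
Variables (R : realType) (p : nat).
Local Notation k := p.+1.
Implicit Types (A B : k.+1.-tuple R) (Bh mu : k.-tuple R).

Definition order_conditions A B Bh : Prop :=
  [/\ \sum_(0 <= i < k.+1) A`_i = 0,
      forall m : nat, (m <= k.-1)%N ->
        \sum_(0 <= i < k.+1) A`_i * (- i%:R) ^+ m.+1
          = m.+1%:R * \sum_(0 <= i < k.+1) B`_i * (- i%:R) ^+ m /\
        \sum_(0 <= i < k.+1) A`_i * (- i%:R) ^+ m.+1
          = m.+1%:R * \sum_(1 <= i < k.+1) Bh`_i.-1 * (- i%:R) ^+ m,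
      \sum_(0 <= i < k.+1) A`_i * (- i%:R) = 1,
      \sum_(0 <= i < k.+1) B`_i = 1
    & \sum_(1 <= i < k.+1) Bh`_i.-1 = 1].

Definition avec A : k.-tuple R := [tuple \sum_(0 <= j < i.+1) A`_j | i < k].

Definition nuvec mu : k.+1.-tuple R :=
  [tuple if i == 0%N :> nat then mu`_0
         else if i == k :> nat then - mu`_k.-1
         else mu`_i - mu`_i.-1 | i < k.+1].

Definition bhat Bh (i : nat) : R := \sum_(1 <= j < i.+1) Bh`_j.-1 - 1.

Definition ctilde Bh mu (i : nat) : R :=
  (i != 0%N)%:R * `|bhat Bh i| * \sum_(0 <= j < k) `|mu`_j|
  + `|mu`_i| * \sum_(1 <= j < k) `|bhat Bh j|
  + `|mu`_i|
  + (`|mu`_i| + \sum_(i <= j < k) j%:R * `|mu`_j|) * (i != 0%N)%:R.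

Definition chat Bh mu (i : nat) : R := \sum_(i <= j < k) ctilde Bh mu j.

End Coefficients.

Section Feasibility.
Variable R : realType.

Definition genpoly r (s : r.-tuple R) : {poly R} :=
  \sum_(i < r) s`_i *: 'X^(r.-1 - i)%N.

Definition genpolyC r (s : r.-tuple R) : {poly R[i]} :=
  map_poly (real_complex R) (genpoly s).

Definition expi (t : R) : R[i] := (cos t +i* sin t)%C.

Variable p : nat.
Local Notation k := p.+1.

Definition FP (A B : k.+1.-tuple R) (mu : k.-tuple R) (alpha beta : R) : Prop :=
  let a := avec A in
  let nu := nuvec mu in
  [/\ 0 < alpha /\ 0 < beta,
      \sum_(0 <= i < k.+1) B`_i = 1 /\ \sum_(0 <= i < k) mu`_i = 1,
      (* size is degree + 1 *)
      [/\ size (genpoly a) = k, size (genpoly mu) = k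
        & size (genpoly B) = k.+1],
      (forall z : R[i], root (genpolyC mu) z -> `|z| < 1)
        /\ (coprimep (genpoly a) (genpoly mu)
            /\ coprimep (genpoly B) (genpoly nu))
    & exists Pa PB : {poly R},
      [/\ forall t : R, 0 <= t <= pi ->
            Pa.[cos t]
              = complex.Re ((genpolyC a).[expi t] * (genpolyC mu).[expi (- t)]),
          forall t : R, 0 < t <= pi ->
            PB.[cos t]
              = complex.Re ((genpolyC B).[expi t] * (genpolyC nu).[expi (- t)])
                / (2 * (1 - cos t))
        & forall x : R, -1 <= x <= 1 -> alpha <= Pa.[x] /\ beta <= PB.[x]]].

Definition qform m (U : 'M[R]_m) (x : 'cV[R]_m) : R := (x^T *m U *m x) 0 0.

Definition posdefmx m (G : 'M[R]_m) : Prop :=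
  G^T = G /\ forall x : 'cV[R]_m, x != 0 -> 0 < qform G x.

Definition Umx m (s t : m.+1.-tuple R) (G : 'M[R]_m) : 'M[R]_m.+1 :=
  let vs := \col_(i < m.+1) s`_i in
  let vt := \col_(i < m.+1) t`_i in
  2^-1 *: (vs *m vt^T + vt *m vs^T)
  - castmx (addn1 m, addn1 m) (block_mx G 0 0 (0 : 'M[R]_1))
  + block_mx (0 : 'M[R]_1) 0 0 G.

Definition PDC (A B : k.+1.-tuple R) (mu : k.-tuple R)
    (Ga : 'M[R]_p) (GB : 'M[R]_k) (alpha beta : R) : Prop :=
  (forall x : 'cV[R]_k,
     alpha * x ord0 0 ^+ 2 <= qform (Umx mu (avec A) Ga) x) /\
  (forall y : 'cV[R]_k.+1,
     beta * (y ord0 0 - y (lift ord0 ord0) 0) ^+ 2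
       <= qform (Umx (nuvec mu) B GB) y).

End Feasibility.

Section Spaces.
Variable R : realType.

Record hilbertType := Hilbert {
  hilbert_sort :> completeNormedModType R;
  hdot : {dot hilbert_sort for idfun};
  hdotE : forall v : hilbert_sort, hdot v v = `|v| ^+ 2 }.

Definition compact_embedding (U W : hilbertType) (j : {linear U -> W}) : Prop :=
  [/\ injective j, continuous j
    & forall X : set U, bounded_set X -> precompact (j @` X)].

(* The dual of V consists of the continuous linear functionals, taken inside
   the module of all functions V -> R; the duality pairing is application. *)
Definition in_dual (V : hilbertType) (phi : V -> R^o) : Prop :=
  linear phi /\ continuous phi.

Record domain := Domain {
  dom_disp : measure_display;
  dom_type : measurableType dom_disp;
  dom_measure : {measure set dom_type -> \bar R};
  dom_set : set dom_type }.

Definition lebR : {sigma_finite_measure set (measurableTypeR R) -> \bar R} :=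
  lebesgue_measure.

Definition side : set (measurableTypeR R) := [set x | - pi < x < pi].

(* The cube (-pi, pi)^d; only d = 1, 2, 3 are meant. *)
Definition Omega (d : nat) : domain :=
  match d with
  | 1 => Domain lebR side
  | 2 => Domain (lebR \x lebR)%E (side `*` side)
  | _ => Domain ((lebR \x lebR) \x lebR)%E ((side `*` side) `*` side)
  end.

End Spaces.

Arguments dom_set {R} _ _.

Section GradientFlow.
Variables (R : realType) (d : nat).
Local Notation dom := (Omega R d).
Local Notation mu_dom := (dom_measure dom).

(* Elements of spH are classes of functions on the domain modulo equality a.e.;
   fn v is a representative of v.  Membership of S and V in the function spaces
   is expressed by the injections jS and jV. *)
Record flow_data := FlowData {
  spH : hilbertType R;
  spV : hilbertType R;
  spS : hilbertType R;
  fn : spH -> dom_type dom -> R;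
  jV : {linear spV -> spH};
  jS : {linear spS -> spV};
  opL : {linear spS -> spV};
  opM : {linear spV -> (spV -> R^o)};
  potF : R -> R;
  nonlin : spS -> spV;
  zeta : R;
  eta_exp : R;
  ellf : R }.

Section Notions.
Variable D : flow_data.

Definition jSH (u : spS D) : spH D := jV D (jS D u).

Definition dotH (v w : spH D) : R := hdot (spH D) v w.

(* The embedding of H into V' of the Gelfand triple. *)
Definition to_dual (v : spH D) : spV D -> R^o := fun w => dotH v (jV D w).

(* The value 0 outside the range of M is never met: under flow_axioms, M is a
   bijection of V onto its dual (Lax-Milgram). *)
Definition Minv (phi : spV D -> R^o) : spV D := xget 0 [set v | opM D v = phi].

Definition MinvH (v : spH D) : spH D := jV D (Minv (to_dual v)).

Definition normMinv (v : spH D) : R := Num.sqrt (dotH v (- MinvH v)).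

Definition normL (v : spS D) : R := Num.sqrt (dotH (jV D (opL D v)) (jSH v)).

Definition potential (u : spS D) : R :=
  \int[mu_dom]_(x in dom_set dom) potF D (fn (jSH u) x).

End Notions.

Record flow_axioms (D : flow_data) : Prop := FlowAxioms {
  fn_measurable : forall v : spH D, measurable_fun (dom_set dom) (fn v);
  fn_square : forall v : spH D,
    mu_dom.-integrable (dom_set dom) (fun x => (fn v x ^+ 2)%:E);
  fn_linear : forall (a : R) (v w : spH D),
    {ae mu_dom, forall x, dom_set dom x ->
       fn (a *: v + w) x = a * fn v x + fn w x};
  fn_dot : forall v w : spH D,
    dotH v w = \int[mu_dom]_(x in dom_set dom) (fn v x * fn w x);
  jS_embedding : compact_embedding (jS D);
  jV_embedding : compact_embedding (jV D);
  jV_dense : dense (range (jV D));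
  L_sym : forall u v : spS D,
    dotH (jV D (opL D u)) (jSH v) = dotH (jSH u) (jV D (opL D v));
  L_ge0 : forall v : spS D, 0 <= dotH (jV D (opL D v)) (jSH v);
  M_dual : forall u : spV D, in_dual (opM D u);
  M_sym : forall u v : spV D, opM D u v = opM D v u;
  M_bounded : exists2 CM : R, 0 < CM &
    forall u v : spV D, `|opM D u v| <= CM * `|u| * `|v|;
  M_coercive : exists2 cM : R, 0 < cM &
    forall v : spV D, cM * `|v| ^+ 2 <= - opM D v v;
  zeta_gt0 : 0 < zeta D;
  eta_itv : 0 < eta_exp D <= 1;
  interpolation : forall v : spS D,
    `|jSH v| <= zeta D * normMinv (jSH v) `^ eta_exp D
                * normL v `^ (1 - eta_exp D);
  F_derivable : forall x : R, derivable (potF D) x 1;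
  f_potential : forall u : spS D,
    {ae mu_dom, forall x, dom_set dom x ->
       fn (jV D (nonlin u)) x = derive1 (potF D) (fn (jSH u) x)};
  potential_integrable : forall u : spS D,
    mu_dom.-integrable (dom_set dom) (fun x => (potF D (fn (jSH u) x))%:E);
  potential_ge0 : forall u : spS D, 0 <= potential u;
  ellf_gt0 : 0 < ellf D;
  f_lipschitz : forall u v : spS D,
    `|jV D (nonlin u) - jV D (nonlin v)| <= ellf D * `|jSH u - jSH v|;
  potential_quadratic : forall u v : spS D,
    `|potential u - potential v - dotH (jV D (nonlin v)) (jSH u - jSH v)|
      <= ellf D / 2 * `|jSH u - jSH v| ^+ 2 }.

Section Scheme.
Variables (D : flow_data) (p : nat).
Local Notation k := p.+1.
Variables (A B : k.+1.-tuple R) (Bh mu : k.-tuple R).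

Definition imex_solution (tau : R) (N : nat) (u : nat -> spS D) : Prop :=
  forall n : nat, (k.-1 <= n <= N.-1)%N ->
    \sum_(0 <= i < k.+1) A`_i *: to_dual (jSH (u (n.+1 - i)%N))
    = tau *: opM D (\sum_(0 <= i < k.+1) B`_i *: opL D (u (n.+1 - i)%N)
                  + \sum_(1 <= i < k.+1) Bh`_i.-1 *: nonlin (u (n.+1 - i)%N)).

Definition delta (u : nat -> spS D) (j : nat) : spH D := jSH (u j) - jSH (u j.-1).

Definition energy (Ga : 'M[R]_p) (GB : 'M[R]_k) (tau : R)
    (u : nat -> spS D) (n : nat) : R :=
  - (tau^-1 * \sum_(i < p) \sum_(j < p)
       Ga i j * dotH (delta u (n - i)) (MinvH (delta u (n - j))))
  + \sum_(i < k) \sum_(j < k)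
       GB i j * dotH (jSH (u (n - i)%N)) (jV D (opL D (u (n - j)%N)))
  + \sum_(0 <= i < k) mu`_i * potential (u (n - i)%N)
  + ellf D / 2
    * \sum_(1 <= i < k) chat Bh mu i * `|delta u (n.+1 - i)| ^+ 2.

Definition tau_max (alpha beta : R) : R :=
  let etab := (1 - eta_exp D) / eta_exp D in
  alpha * beta `^ etab
  / ((ellf D * chat Bh mu 0 / 2) `^ (1 + etab) * eta_exp D * (1 - eta_exp D) `^ etab
     * zeta D `^ (2 + 2 * etab)).

End Scheme.
End GradientFlow.

(* Main.v *)
Require Import Defs.
From HB Require Import structures.
From mathcomp Require Import all_boot all_order all_algebra.
From mathcomp Require Import all_classical all_reals all_analysis.
From mathcomp Require Import ring lra complex.

Set Implicit Arguments.
Unset Strict Implicit.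
Unset Printing Implicit Defensive.

Import Order.TTheory GRing.Theory Num.Theory.
Import numFieldNormedType.Exports.

Local Open Scope ring_scope.

(**
Write k for the number of steps, w_i for u^{n+1-i} and d_i for w_i - w_{i+1}.
Apply M^{-1} to the scheme and test it with the sum of the mu_i d_i, which is also
the sum of the nu_i w_i.  Since the A_i sum to zero, summation by parts turns the
left side into the sum of the a_i d_i, and one step becomes ([tested_scheme])
<<
  (1/tau) (sum mu_i d_i, sum a_i d_i)_{-M^{-1}} + (L sum B_i w_i, sum nu_i w_i)
     + (sum Bh_i f(w_i), sum mu_i d_i) = 0.
>>
The first two terms have the shape handled by G-stability: the conditions PDC say
that the product of the two linear forms exceeds a difference of G-quadratic forms
by a square.  PDC speaks of real vectors, but a matrix that is positive
semidefinite on R^m stays so when the products x_i x_j are replaced by b(v_i, v_j)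
for any semi-inner product b ([psd_form_ge0]); this gives [G_stability] for
b = -M^{-1} on H and b = L on S.  That M^{-1} exists on H is the Lax-Milgram
theorem ([lax_milgram], proved by minimizing the quadratic functional), and its
symmetry and sign come from those of M.

In the third term the explicit extrapolation of f is f(w_1) plus multiples of
increments of f, so that Lipschitz continuity and the quadratic bound on the
potential show that the term falls below the mu-weighted difference of potentials by
at most ell_f / 2 times the sum of the ctilde_i |d_i|^2 ([nonlinear_estimate]).  The
weights chat_i of the modified energy are the tails of the ctilde_i, so all
|d_i|^2 telescope away except chat_0 |d_0|^2 ([chat_telescope]).  The interpolation
inequality and a weighted Young inequality ([weighted_Young]) bound this last
quantity by the squares gained from G-stability, and tau_max is exactly the
value of tau at which the constants match.  All this works for every k and is
[energy_decay].

For BDF6 it remains to check numbers.  U_B minus its prescribed lower bound is the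
rank-one square of the row l = (1, -2, 1, 0, -1, 2, -1), and 12 G_B is a sum of
squares of the truncated shifts of l.  U_a and G_a are handled by rounded Cholesky
factorizations.  The polynomials of the feasibility conditions are explicit:
P_B - 1/6 is (8/3) x^2 (1 - x)^2 (1 + x), and P_a - 1/6 is bounded below by hand.
Both the location of the roots of M(z; mu) and its coprimality with M(z; a) follow
from one remark: a polynomial whose constant coefficient exceeds the sum of the
moduli of the others does not vanish on the closed unit disk
([dominant_constant_neq0]).  Suitable polynomial combinations with this property
exist with small integer coefficients.
*)

(** * Semi-inner products and positive semidefinite matrices *)

(** Three forms of this kind occur: the product of H, the form of -M^{-1} on H, and
    the form of L on S.  The last one may vanish on nonzero vectors. *)
Definition semi_inner {R : realType} {V : lmodType R} (b : V -> V -> R) : Prop :=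
  [/\ forall x y, b x y = b y x,
      forall a x y z, b (a *: x + y) z = a * b x z + b y z
    & forall x, 0 <= b x x].

Section SemiInner.
Context {R : realType} {V : lmodType R} {b : V -> V -> R}.
Hypothesis hb : semi_inner b.

Lemma siC x y : b x y = b y x.
Proof. by case: hb. Qed.

Lemma si_ge0 x : 0 <= b x x.
Proof. by case: hb. Qed.

Lemma si0l z : b 0 z = 0.
Proof. by have [_ /(_ 1 0 0 z) + _] := hb; rewrite scale1r addr0; lra. Qed.

Lemma siZl a x z : b (a *: x) z = a * b x z.
Proof. by have [_ /(_ a x 0 z) + _] := hb; rewrite addr0 si0l addr0. Qed.

Lemma siDl x y z : b (x + y) z = b x z + b y z.
Proof. by have [_ /(_ 1 x y z) + _] := hb; rewrite scale1r mul1r. Qed.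

Lemma siZr a x z : b z (a *: x) = a * b z x.
Proof. by rewrite siC siZl siC. Qed.

Lemma siDr x y z : b z (x + y) = b z x + b z y.
Proof. by rewrite siC siDl !(siC z). Qed.

Lemma si_suml I (r : seq I) (P : pred I) (c : I -> R) (v : I -> V) z :
  b (\sum_(i <- r | P i) c i *: v i) z = \sum_(i <- r | P i) c i * b (v i) z.
Proof.
elim/big_rec2 : _ => [|i y x _ <-]; first exact: si0l.
by rewrite siDl siZl.
Qed.

Lemma si_sumr I (r : seq I) (P : pred I) (c : I -> R) (v : I -> V) z :
  b z (\sum_(i <- r | P i) c i *: v i) = \sum_(i <- r | P i) c i * b z (v i).
Proof. by rewrite siC si_suml; under eq_bigr do rewrite siC. Qed.

Lemma si_sum2 n m (c : 'I_n -> R) (d : 'I_m -> R) (v : 'I_n -> V) (w : 'I_m -> V) :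
  b (\sum_(i < n) c i *: v i) (\sum_(j < m) d j *: w j)
    = \sum_(i < n) \sum_(j < m) c i * d j * b (v i) (w j).
Proof.
rewrite si_suml; apply: eq_bigr => i _.
by rewrite si_sumr mulr_sumr; apply: eq_bigr => j _; rewrite mulrA.
Qed.

(** One step of Gaussian elimination on the form.  With x / 0 = 0, the second
    hypothesis says that a zero pivot has a zero row, so that the identity needs no
    case distinction. *)
Lemma si_complete_square n (U : 'I_n.+1 -> 'I_n.+1 -> R) (v : 'I_n.+1 -> V) :
    (forall i j, U i j = U j i) ->
    (forall j, U ord0 ord0 * (U ord0 j / U ord0 ord0) = U ord0 j) ->
  let c j := U ord0 (lift ord0 j) / U ord0 ord0 in
  let w := v ord0 + \sum_(j < n) c j *: v (lift ord0 j) in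
  \sum_(i < n.+1) \sum_(j < n.+1) U i j * b (v i) (v j)
  = U ord0 ord0 * b w w
    + \sum_(i < n) \sum_(j < n)
        (U (lift ord0 i) (lift ord0 j) - U ord0 ord0 * (c i * c j))
        * b (v (lift ord0 i)) (v (lift ord0 j)).
Proof.
move=> symU pivU c w; rewrite big_ord_recl big_ord_recl /=.
have pivc j : U ord0 ord0 * c j = U ord0 (lift ord0 j) by exact: pivU.
under [X in _ + X = _]eq_bigr do rewrite big_ord_recl /=.
rewrite big_split /= /w siDl !siDr si_sum2 si_suml si_sumr.
rewrite !mulrDr !mulr_sumr -!addrA; congr (_ + _).
under [X in _ = X + _]eq_bigr do rewrite mulrA pivc.
congr (_ + _).
under [X in _ = X + _]eq_bigr do rewrite mulrA pivc.
congr (_ + _).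
  by apply: eq_bigr => i _; rewrite siC symU.
rewrite -big_split /=; apply: eq_bigr => i _.
rewrite mulr_sumr -big_split /=; apply: eq_bigr => j _; ring.
Qed.

Lemma si_sqr t x y :
  b (x + t *: y) (x + t *: y) = b x x + 2 * t * b x y + t ^+ 2 * b y y.
Proof.
by rewrite siDl !siDr !siZl !siZr (siC y x); ring.
Qed.

Lemma si_CauchySchwarz x y : b x y ^+ 2 <= b x x * b y y.
Proof.
have [y0|y0] := eqVneq (b y y) 0.
  rewrite y0 mulr0; apply/negP => /negP; rewrite -ltNge => B0.
  have B0' : b x y != 0 by apply: contraTneq B0 => ->; rewrite expr0n ltxx.
  have := si_ge0 (x + (- (b x x + 1) / (2 * b x y)) *: y).
  rewrite si_sqr y0 mulr0 addr0 (_ : _ + _ = -1); last by field.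
  lra.
have := si_ge0 (x + (- b x y / b y y) *: y).
rewrite si_sqr (_ : _ + _ = b x x - b x y ^+ 2 / b y y); last by field.
by rewrite subr_ge0 ler_pdivrMr // lt_def y0 si_ge0.
Qed.

Lemma siNl x z : b (- x) z = - b x z.
Proof. by rewrite -scaleN1r siZl mulN1r. Qed.

Lemma siNr x z : b z (- x) = - b z x.
Proof. by rewrite siC siNl siC. Qed.

Lemma si_double_le x y : 2 * b x y <= b x x + b y y.
Proof. by have := si_ge0 (x + -1 *: y); rewrite si_sqr; lra. Qed.

(** Absorbs an increment of a Lipschitz map into squares of increments of its
    argument, without a detour through norms. *)
Lemma si_lipschitz l x y w :
    0 < l -> b x x <= l ^+ 2 * b w w ->
  `|b x y| <= l / 2 * (b w w + b y y).
Proof.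
move=> l0 xw; rewrite ler_norml; apply/andP; split.
- have := si_ge0 (x + l *: y); rewrite si_sqr => h.
  rewrite -(ler_pM2l l0); lra.
- have := si_ge0 (x + (- l) *: y); rewrite si_sqr => h.
  rewrite -(ler_pM2l l0); lra.
Qed.

(** Jensen's inequality for the square. *)
Lemma si_sqr_sum I (r : seq I) (v : I -> V) :
  b (\sum_(i <- r) v i) (\sum_(i <- r) v i)
    <= (size r)%:R * \sum_(i <- r) b (v i) (v i).
Proof.
elim: r => [|i r IHr]; first by rewrite !big_nil si0l mulr0.
rewrite !big_cons /= -[X in v i + X]scale1r si_sqr.
have cross : 2 * 1 * b (v i) (\sum_(j <- r) v j)
    <= (size r)%:R * b (v i) (v i) + \sum_(j <- r) b (v j) (v j).
  elim: r {IHr} => [|j r IHr]; first by rewrite !big_nil siC si0l mulr0 mul0r addr0.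
  rewrite !big_cons siDr /= -natr1.
  by have := si_double_le (v i) (v j); lra.
rewrite -natr1; lra.
Qed.
End SemiInner.

Lemma semi_inner_mulr (R : realType) :
  semi_inner (V := R^o) (fun x y : R => x * y).
Proof.
split=> [x y|a x y z|x]; [exact: mulrC| |exact: sqr_ge0].
by rewrite mulrDl mulrA.
Qed.

(** Positivity on real vectors suffices: eliminating one variable at a time
    writes the form as a combination of squares with nonnegative weights, and the
    same elimination is valid for every semi-inner product. *)
Lemma psd_form_ge0 (R : realType) (V : lmodType R) (b : V -> V -> R) n
    (U : 'I_n -> 'I_n -> R) (v : 'I_n -> V) :
    semi_inner b -> (forall i j, U i j = U j i) ->
    (forall x : 'I_n -> R, 0 <= \sum_(i < n) \sum_(j < n) U i j * (x i * x j)) ->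
  0 <= \sum_(i < n) \sum_(j < n) U i j * b (v i) (v j).
Proof.
move=> hb; elim: n => [|n IHn] in U v *; first by rewrite big_ord0.
move=> symU psdU.
have diag2 j : j != ord0 -> forall s t : R, 0 <= U ord0 ord0 * s ^+ 2
    + 2 * (U ord0 j * s * t) + U j j * t ^+ 2.
  move=> j0 s t.
  pose F i := if i == ord0 then s else if i == j then t else 0.
  have := psdU F; have F0 k : k != ord0 -> k != j -> F k = 0.
    by rewrite /F => /negPf-> /negPf->.
  have Fs : F ord0 = s by rewrite /F eqxx.
  have Ft : F j = t by rewrite /F (negPf j0) eqxx.
  have in2 i : \sum_(k < n.+1) U i k * (F i * F k) =
      F i * (U i ord0 * s + U i j * t).
    rewrite (bigD1 ord0) //= (bigD1 j) //= big1 => [|k /andP[k0 kj]].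
      by rewrite Fs Ft; ring.
    by rewrite (F0 k) // !mulr0.
  under eq_bigr do rewrite in2.
  rewrite (bigD1 ord0) //= (bigD1 j) //= big1 => [|k /andP[k0 kj]].
    by rewrite Fs Ft (symU j ord0); congr (0 <= _); ring.
  by rewrite (F0 k) // mul0r.
have U00_ge0 : 0 <= U ord0 ord0.
  have := psdU (fun i => (i == ord0)%:R).
  rewrite (bigD1 ord0) //= (bigD1 ord0) //= !big1 => [|k /negPf k0|k /negPf k0].
  - by rewrite ?eqxx ?mulr1n !mulr1 !addr0.
  - by rewrite k0 big1 // => l _; rewrite /= mul0r mulr0.
  - by rewrite k0 /= !mulr0.
have pivU j : U ord0 ord0 * (U ord0 j / U ord0 ord0) = U ord0 j.
  have [U0|U0] := eqVneq (U ord0 ord0) 0; last by rewrite mulrC divfK.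
  have [->|j0] := eqVneq j ord0; first by rewrite U0 mul0r.
  rewrite U0 mul0r; apply/esym/eqP; rewrite -sqrf_eq0 -[_ == 0]negbK.
  apply/negP => B0.
  have {}B0 : 0 < U ord0 j ^+ 2 by rewrite lt_def B0 sqr_ge0.
  (* With a zero pivot the form is affine in the first coordinate; this value
     makes it negative. *)
  have := diag2 j j0 (- (U j j + 1) / U ord0 j) 1.
  have {}B0 : U ord0 j != 0 by move: B0; rewrite lt_def sqrf_eq0 => /andP[].
  rewrite U0 (_ : 0 * _ + _ + _ = - U j j - 2); last by field.
  have := diag2 j j0 0 1; rewrite U0; lra.
rewrite si_complete_square // addr_ge0 ?mulr_ge0 ?si_ge0 //.
set c := fun j => U ord0 (lift ord0 j) / U ord0 ord0.
apply: IHn => [i j|x]; first by rewrite symU (mulrC (_ / _)).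
(* The first coordinate that annihilates the completed square. *)
pose X i := oapp x (- \sum_(j < n) c j * x j) (unlift ord0 i).
have Xl j : X (lift ord0 j) = x j by rewrite /X liftK.
have := psdU X; rewrite (si_complete_square (semi_inner_mulr R)) // -/c.
have -> : X ord0 + \sum_(j < n) c j *: (X (lift ord0 j) : R^o) = 0.
  under eq_bigr do rewrite Xl.
  by rewrite /X unlift_none addNr.
rewrite mul0r mulr0 add0r.
by under eq_bigr do under eq_bigr do rewrite !Xl.
Qed.

Lemma qformE (R : realType) n (U : 'M[R]_n) (x : 'cV[R]_n) :
  qform U x = \sum_(i < n) \sum_(j < n) U i j * (x i 0 * x j 0).
Proof.
rewrite /qform mxE exchange_big /=; apply: eq_bigr => j _.
rewrite mxE mulr_suml; apply: eq_bigr => i _.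
by rewrite mxE; ring.
Qed.

Lemma qform_le_form (R : realType) (V : lmodType R) (b : V -> V -> R) n
    (U : 'M[R]_n) (c : 'I_n -> R) (gamma : R) (v : 'I_n -> V) :
    semi_inner b -> U^T = U ->
    (forall x : 'cV[R]_n, gamma * (\sum_(i < n) c i * x i 0) ^+ 2 <= qform U x) ->
  gamma * b (\sum_(i < n) c i *: v i) (\sum_(i < n) c i *: v i)
    <= \sum_(i < n) \sum_(j < n) U i j * b (v i) (v j).
Proof.
move=> hb symU posU.
have split_sum (W : lmodType R) (b' : W -> W -> R) (w : 'I_n -> W) :
    semi_inner b' ->
    \sum_(i < n) \sum_(j < n) (U i j - gamma * (c i * c j)) * b' (w i) (w j)
    = \sum_(i < n) \sum_(j < n) U i j * b' (w i) (w j)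
      - gamma * b' (\sum_(i < n) c i *: w i) (\sum_(i < n) c i *: w i).
  move=> hb'; rewrite (si_sum2 hb') mulr_sumr -sumrB; apply: eq_bigr => i _.
  by rewrite mulr_sumr -sumrB; apply: eq_bigr => j _; ring.
rewrite -subr_ge0 -split_sum //; apply: psd_form_ge0 => // [i j|x].
  by rewrite -{1}symU mxE (mulrC (c i)).
rewrite (split_sum _ _ (x : 'I_n -> R^o) (semi_inner_mulr R)) subr_ge0.
have := posU (\col_i x i); rewrite qformE -expr2.
under eq_bigr do rewrite mxE.
by under [X in _ <= X -> _]eq_bigr do under eq_bigr do rewrite !mxE.
Qed.

Section Umx.
Context {R : realType} {m : nat}.
Implicit Types (s t : m.+1.-tuple R) (G : 'M[R]_m).

Lemma tr_Umx s t G : G^T = G -> (Umx s t G)^T = Umx s t G.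
Proof.
move=> symG; have trQ : (block_mx (0 : 'M[R]_1) 0 0 G)^T = block_mx 0 0 0 G.
  by rewrite tr_block_mx !trmx0 symG.
rewrite /Umx !linearD linearN linearZ /= trmx_cast /= tr_block_mx !trmx0 symG.
congr (_ - _ + _); last exact: trQ.
by rewrite ?(linearD, linearZ) /= ?trmx_mul ?trmxK addrC.
Qed.

(** The two shifted copies of G in U turn into a difference of G-forms on the
    sequences v_0, v_1, ... and v_1, v_2, ...: the telescoping part of G-stability. *)
Lemma sum_Umx s t G (K : nat -> nat -> R) : (forall i j, K i j = K j i) ->
  \sum_(i < m.+1) \sum_(j < m.+1) Umx s t G i j * K i j
  = \sum_(i < m.+1) \sum_(j < m.+1) s`_i * t`_j * K i j
    - \sum_(i < m) \sum_(j < m) G i j * K i j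
    + \sum_(i < m) \sum_(j < m) G i j * K i.+1 j.+1.
Proof.
move=> symK.
pose P := castmx (addn1 m, addn1 m) (block_mx G 0 0 (0 : 'M[R]_1)).
pose Q : 'M[R]_m.+1 := block_mx (0 : 'M[R]_1) 0 0 G.
have -> : \sum_(i < m.+1) \sum_(j < m.+1) Umx s t G i j * K i j
  = \sum_(i < m.+1) \sum_(j < m.+1) 2^-1 * (s`_i * t`_j + t`_i * s`_j) * K i j
    - \sum_(i < m.+1) \sum_(j < m.+1) P i j * K i j
    + \sum_(i < m.+1) \sum_(j < m.+1) Q i j * K i j.
  rewrite -sumrB -big_split /=; apply: eq_bigr => i _.
  rewrite -sumrB -big_split /=; apply: eq_bigr => j _.
  have -> : Umx s t G i j
    = 2^-1 * (s`_i * t`_j + t`_i * s`_j) - P i j + Q i j; last by ring.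
  rewrite /Umx -/P -/Q; move: P Q => P Q.
  by rewrite !mxE !big_ord1 !mxE.
congr (_ - _ + _).
- have e : \sum_(i < m.+1) \sum_(j < m.+1) t`_i * s`_j * K i j
         = \sum_(i < m.+1) \sum_(j < m.+1) s`_i * t`_j * K i j.
    rewrite exchange_big /=; apply: eq_bigr => i _; apply: eq_bigr => j _.
    by rewrite symK; ring.
  transitivity (2^-1 * (\sum_(i < m.+1) \sum_(j < m.+1) s`_i * t`_j * K i j
      + \sum_(i < m.+1) \sum_(j < m.+1) t`_i * s`_j * K i j)).
    rewrite -big_split mulr_sumr /=; apply: eq_bigr => i _.
    by rewrite -big_split mulr_sumr /=; apply: eq_bigr => j _; ring.
  by rewrite e; field.
- have co k : cast_ord (esym (addn1 m)) (widen_ord (leqnSn m) k) = lshift 1 k.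
    exact: val_inj.
  have cm : cast_ord (esym (addn1 m)) ord_max = rshift m ord0.
    by apply: val_inj; rewrite /= addn0.
  rewrite big_ord_recr /= [X in _ + X]big1 ?addr0 => [|j _]; last first.
    rewrite /P castmxE /= cm.
    by case: (split_ordP (cast_ord (esym (addn1 m)) j)) => k ->;
       rewrite ?block_mxEdl ?block_mxEdr ?mxE ?mul0r //.
  apply: eq_bigr => i _; rewrite big_ord_recr /= /P !castmxE /= cm !co.
  rewrite block_mxEur mxE mul0r addr0; apply: eq_bigr => j _.
  by rewrite castmxE /= !co block_mxEul.
- have lr (k : 'I_m) : lift ord0 k = rshift 1 k by exact: val_inj.
  have l0 : ord0 = lshift m (ord0 : 'I_1) by exact: val_inj.
  have Q0 j : Q ord0 j = 0.
    rewrite l0; case: (split_ordP (j : 'I_(1 + m))) => k ->.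
      by apply: etrans (block_mxEul 0 0 0 G ord0 k) _; rewrite mxE.
    by apply: etrans (block_mxEur 0 0 0 G ord0 k) _; rewrite mxE.
  have Ql0 i : Q (lift ord0 i) ord0 = 0.
    by rewrite lr l0; apply: etrans (block_mxEdl 0 0 0 G i ord0) _; rewrite mxE.
  have Qll i j : Q (lift ord0 i) (lift ord0 j) = G i j.
    by rewrite !lr; exact: (block_mxEdr 0 0 0 G).
  rewrite big_ord_recl [X in X + _]big1 ?add0r => [|j _]; last by rewrite Q0 mul0r.
  apply: eq_bigr => i _; rewrite big_ord_recl Ql0 mul0r add0r.
  by apply: eq_bigr => j _; rewrite Qll.
Qed.

(** Dahlquist's G-stability inequality with a gain: v_0 is the newest entry, and the
    square weighted by gamma is what the matrix inequality leaves over. *)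
Lemma G_stability (V : lmodType R) (b : V -> V -> R) s t G (gamma : R)
    (c : 'I_m.+1 -> R) (v : nat -> V) :
    semi_inner b -> G^T = G ->
    (forall x : 'cV[R]_m.+1, gamma * (\sum_(i < m.+1) c i * x i 0) ^+ 2
                 <= qform (Umx s t G) x) ->
  \sum_(i < m) \sum_(j < m) G i j * b (v i) (v j)
    + gamma * b (\sum_(i < m.+1) c i *: v i) (\sum_(i < m.+1) c i *: v i)
  <= \sum_(i < m) \sum_(j < m) G i j * b (v i.+1) (v j.+1)
    + b (\sum_(i < m.+1) s`_i *: v i) (\sum_(i < m.+1) t`_i *: v i).
Proof.
move=> hb symG posU.
have := qform_le_form (fun i : 'I_m.+1 => v i) hb (tr_Umx s t symG) posU.
rewrite (sum_Umx s t G (K := fun i j => b (v i) (v j))) => [|i j]; last exact: siC.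
rewrite -(si_sum2 hb (fun i => s`_i) (fun i => t`_i) (fun i => v i) (fun i => v i)).
lra.
Qed.
End Umx.

(** * The Lax-Milgram theorem for symmetric forms *)

Section LaxMilgram.
Context {R : realType} {V : completeNormedModType R}.
Variables (a : V -> V -> R) (psi : V -> R) (C c K : R).
Hypotheses (ha : semi_inner a) (c0 : 0 < c).
Hypothesis a_bounded : forall u v, `|a u v| <= C * `|u| * `|v|.
Hypothesis a_coercive : forall v, c * `|v| ^+ 2 <= a v v.
Hypothesis psi_linear : forall (t : R) x y, psi (t *: x + y) = t * psi x + psi y.
Hypothesis psi_bounded : forall v, `|psi v| <= K * `|v|.

Let J v := a v v - 2 * psi v.

Let JE t x y : J (x + t *: y) = J x + 2 * t * (a x y - psi y) + t ^+ 2 * a y y.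
Proof. by rewrite /J si_sqr // (addrC x) psi_linear; ring. Qed.

(* The infimum of the energy functional, which is bounded below by coercivity. *)
Let J_lower : exists m, (forall v, m <= J v) /\
  forall e, 0 < e -> exists v, J v < m + e.
Proof.
pose E := range J.
have hE : has_inf E.
  split; first by exists (J 0), 0.
  exists (- (K ^+ 2 / c)) => _ [v _ <-].
  have h1 := a_coercive v; have := psi_bounded v; rewrite ler_norml => /andP[_ h2].
  apply: (@le_trans _ _ (c * `|v| ^+ 2 - 2 * (K * `|v|))); last by rewrite /J; lra.
  rewrite -subr_ge0 (_ : _ - _ = c * (`|v| - K / c) ^+ 2); last by field; rewrite gt_eqF.
  by rewrite mulr_ge0 ?sqr_ge0 // ltW.
exists (inf E); split => [v|e e0].
  by apply: ge_inf; [case: hE|exists v].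
by have [_ [v _ <-] Jv] := inf_adherent e0 hE; exists v.
Qed.

(** A minimizing sequence of [J] is Cauchy by the parallelogram identity and
    coercivity.  The limit is not shown to minimize [J]; instead the Euler-Lagrange
    residual of the sequence tends to zero, and the residual is continuous. *)
Lemma lax_milgram : exists v, forall w, a v w = psi w.
Proof.
have [m [mJ Jm]] := J_lower.
have /choice[v vP] n : exists v, J v < m + n.+1%:R^-1 by exact: Jm.
have dist_v n k : c * `|v n - v k| ^+ 2 <= 2 * n.+1%:R^-1 + 2 * k.+1%:R^-1.
  apply: le_trans (a_coercive _) _.
  (* The midpoint has energy at least m. *)
  have := mJ (v k + 2^-1 *: (v n - v k)); rewrite JE.
  have := JE 1 (v k) (v n - v k); rewrite scale1r (addrC (v k)) subrK.
  have := vP n; have := vP k; move: (n.+1%:R^-1) (k.+1%:R^-1) => p q; lra.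
have v_cvg : cvg (v @ \oo)%classic.
  apply/cauchy_cvgP/cauchy_exP => e e0.
  have ce : 0 < c * e ^+ 2 / 4 by rewrite divr_gt0 ?mulr_gt0 ?exprn_gt0.
  near \oo%classic => N; exists (v N).
  exists N => //= n Nn; rewrite -ball_normE /=.
  have N_small : N.+1%:R^-1 < c * e ^+ 2 / 4 by near: N; exact: near_infty_natSinv_lt (PosNum ce).
  have nN : n.+1%:R^-1 <= N.+1%:R^-1 :> R by rewrite lef_pV2 ?posrE // ler_nat.
  rewrite -(ltr_pXn2r (n := 2)) ?nnegrE ?(ltW e0) // -(ltr_pM2l c0).
  apply: le_lt_trans (dist_v _ _) _.
  by move: nN N_small; move: (n.+1%:R^-1) (N.+1%:R^-1) => p q; lra.
pose l := lim (v @ \oo)%classic; exists l => w.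
pose W := a w w; have W0 : 0 <= W by exact: si_ge0.
have W1 : W + 1 != 0 by rewrite gt_eqF //; lra.
pose r := a l w - psi w.
pose B := 2 * (W + 1) + 2 * (C ^+ 2 * `|w| ^+ 2).
have small e : 0 < e <= 1 -> r ^+ 2 <= B * e.
  move=> /andP[e0 e1].
  have [n [nl ne]] : exists n, `|l - v n| < e /\ n.+1%:R^-1 < e.
    near \oo%classic => n; exists n; split.
      by near: n; exact: (cvgrPdist_lt _ _).1.
    by near: n; exact: near_infty_natSinv_lt (PosNum e0).
  pose q := a (v n) w - psi w.
  have q_small : q ^+ 2 <= (W + 1) * e.
    (* Descending along w from v_n by nearly the optimal amount, with W + 1 in
       place of W to avoid a division by zero, gains at least q^2 / (W + 1). *)
    have := mJ (v n + (- q / (W + 1)) *: w); rewrite JE -/q -/W.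
    have -> : J (v n) + 2 * (- q / (W + 1)) * q + (- q / (W + 1)) ^+ 2 * W =
      J (v n) - (q ^+ 2 / (W + 1) + q ^+ 2 / (W + 1) ^+ 2) by field.
    have : 0 <= q ^+ 2 / (W + 1) ^+ 2 by rewrite divr_ge0 ?sqr_ge0.
    move=> h1 h2; rewrite mulrC -ler_pdivrMr; last by lra.
    by have := vP n; move: ne h1 h2; move: (n.+1%:R^-1) => p; lra.
  have a_small : (a (l - v n) w) ^+ 2 <= C ^+ 2 * `|w| ^+ 2 * e.
    apply: (@le_trans _ _ ((C * `|l - v n| * `|w|) ^+ 2)).
      by rewrite -[leLHS]real_normK ?num_real // lerXn2r ?nnegrE //
         (le_trans _ (a_bounded _ _)).
    rewrite !exprMn mulrAC ler_wpM2l -?exprMn ?sqr_ge0 //.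
    rewrite -[leRHS]mulr1 expr2 ler_pM //; first exact: ltW.
    exact: ltW (lt_le_trans nl e1).
  have -> : r = q + a (l - v n) w.
    by rewrite -(scaleN1r (v n)) (siDl ha) (siZl ha) /r /q; ring.
  have := sqr_ge0 (q - a (l - v n) w); rewrite /B; move: q_small a_small; nra.
apply/eqP; rewrite -subr_eq0 -sqrf_eq0 eq_le sqr_ge0 andbT leNgt; apply/negP.
rewrite -/r => r0.
have B_ge0 : 0 <= B by rewrite /B; have := sqr_ge0 (C * `|w|); rewrite exprMn; lra.
have B0 : 0 < B + r ^+ 2 by lra.
have e01 : 0 < r ^+ 2 / (B + r ^+ 2) / 2 <= 1.
  rewrite divr_gt0 ?divr_gt0 //= ler_pdivrMr // ler_pdivrMr //.
  lra.
have := small _ e01; rewrite mulrA ler_pdivlMr // mulrA ler_pdivlMr //.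
nra.
Unshelve. all: by end_near. Qed.
End LaxMilgram.

(** * The explicit nonlinear term *)

Section NonlinearEstimate.
Context {R : realType} {V : lmodType R} {b : V -> V -> R}.
Hypothesis hb : semi_inner b.

Variables (f w : nat -> V) (Phi : nat -> R) (l : R).
Hypothesis l0 : 0 < l.
Hypothesis lip : forall i j, b (f i - f j) (f i - f j) <= l ^+ 2 * b (w i - w j) (w i - w j).
Hypothesis quad : forall i j,
  `|Phi i - Phi j - b (f j) (w i - w j)| <= l / 2 * b (w i - w j) (w i - w j).

Let de i := w i - w i.+1.
Let x i := b (de i) (de i).

Let x_ge0 i : 0 <= x i.
Proof. exact: si_ge0. Qed.

Lemma increment_telescope j : w 1 - w j.+1 = \sum_(1 <= i < j.+1) de i.
Proof.
rewrite -opprB -(telescope_sumr w (n := 1) (m := j.+1)) // -sumrN.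
by apply: eq_bigr => i _; rewrite opprB.
Qed.

(** The gradient is taken at w_1 throughout, while the quadratic bound on the
    potential has it at w_{j+1}.  The difference costs |w_1 - w_{j+1}|^2, which is
    split into the j increments in between. *)
Lemma potential_increment j :
  `|Phi j - Phi j.+1 - b (f 1) (de j)|
    <= l / 2 * (x j + (j != 0%N)%:R * x j + j%:R * \sum_(1 <= i < j.+1) x i).
Proof.
case: j => [|j] /=.
  have := quad 0 1; rewrite -/(de 0) -/(x 0).
  by rewrite mul0r mul0r !addr0.
have -> : Phi j.+1 - Phi j.+2 - b (f 1) (de j.+1)
  = (Phi j.+1 - Phi j.+2 - b (f j.+2) (de j.+1)) - b (f 1 - f j.+2) (de j.+1).
  by rewrite (siDl hb) (siNl hb); ring.
apply: le_trans (ler_normB _ _) _.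
have h1 := quad j.+1 j.+2; rewrite -/(de _) -/(x _) in h1.
have h2 := si_lipschitz hb (de j.+1) l0 (lip 1 j.+2).
have h3 : b (w 1 - w j.+2) (w 1 - w j.+2) <= j.+1%:R * \sum_(1 <= i < j.+2) x i.
  have := si_sqr_sum hb (index_iota 1 j.+2) de.
  by rewrite -increment_telescope size_iota subn1.
rewrite mul1r; rewrite -/(x _) in h2.
have h4 : l / 2 * b (w 1 - w j.+2) (w 1 - w j.+2)
    <= l / 2 * (j.+1%:R * \sum_(1 <= i < j.+2) x i).
  by rewrite ler_wpM2l // divr_ge0 // ltW.
lra.
Qed.

Variables (p : nat) (Bh mu : p.+1.-tuple R).
Local Notation k := p.+1.
Hypothesis sumBh : \sum_(1 <= i < k.+1) Bh`_i.-1 = 1.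

(** Since the weights sum to one, the extrapolated value is the newest explicit value
    plus increments, with the partial sums minus one as coefficients. *)
Lemma extrapolation_Abel :
  \sum_(1 <= i < k.+1) Bh`_i.-1 *: f i
    = f 1 + \sum_(1 <= i < k) bhat Bh i *: (f i - f i.+1).
Proof.
have gen n : (0 < n)%N -> \sum_(1 <= i < n.+1) Bh`_i.-1 *: f i
    = f 1 + \sum_(1 <= i < n) bhat Bh i *: (f i - f i.+1) + bhat Bh n *: f n.
  elim: n => // -[|n] IHn _.
    by rewrite [X in _ + X + _]big_geq // addr0 /bhat !big_nat1 /= scalerBl scale1r addrC subrK.
  rewrite big_nat_recr //= IHn // [in RHS]big_nat_recr //= -!addrA; congr (_ + (_ + _)).
  have -> : bhat Bh n.+2 = bhat Bh n.+1 + Bh`_n.+1.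
    by rewrite /bhat [in LHS]big_nat_recr //= addrAC.
  by move: (bhat _ _) => c; rewrite scalerBr scalerDl addrA subrK.
by rewrite gen // /bhat sumBh subrr scale0r addr0.
Qed.

(** The constants ctilde_i are the total weight of |d_i|^2 in the two error bounds:
    the extrapolation error and the error of the potential increments. *)
Lemma sum_ctilde :
  \sum_(0 <= i < k) ctilde Bh mu i * x i
  = \sum_(1 <= i < k) \sum_(0 <= j < k) `|bhat Bh i| * `|mu`_j| * (x i + x j)
    + \sum_(0 <= j < k) `|mu`_j|
        * (x j + (j != 0%N)%:R * x j + j%:R * \sum_(1 <= i < j.+1) x i).
Proof.
have s1 (F : nat -> R) : \sum_(0 <= i < k) (i != 0%N)%:R * F i = \sum_(1 <= i < k) F i.
  rewrite big_ltn //= mul0r add0r; apply: eq_big_nat => -[|i] //= _.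
  by rewrite mul1r.
have e1 : \sum_(1 <= i < k) \sum_(0 <= j < k) `|bhat Bh i| * `|mu`_j| * (x i + x j)
  = \sum_(0 <= i < k) (i != 0%N)%:R * (`|bhat Bh i| * x i * \sum_(0 <= j < k) `|mu`_j|)
   + \sum_(0 <= i < k) `|mu`_i| * x i * \sum_(1 <= j < k) `|bhat Bh j|.
  rewrite s1; under [X in _ = _ + X]eq_bigr do rewrite mulr_sumr.
  rewrite [X in _ = _ + X]exchange_big -big_split /=; apply: eq_bigr => i _.
  rewrite mulr_sumr -big_split /=; apply: eq_bigr => j _; ring.
have e2 : \sum_(0 <= j < k) `|mu`_j| * (j%:R * \sum_(1 <= i < j.+1) x i)
  = \sum_(0 <= i < k) (i != 0%N)%:R * ((\sum_(i <= j < k) j%:R * `|mu`_j|) * x i).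
  rewrite s1.
  transitivity (\sum_(0 <= j < k) \sum_(1 <= i < k | (i <= j)%N) j%:R * `|mu`_j| * x i).
    rewrite !big_nat; apply: eq_bigr => j /andP[_ jk].
    rewrite (big_nat_widen _ _ k) // !mulr_sumr; apply: eq_bigr => i _; ring.
  rewrite (exchange_big_dep predT) //= !big_nat; apply: eq_bigr => i /andP[i1 ik].
  by rewrite mulr_suml [in RHS](big_nat_widenl _ 0).
under [X in _ = _ + X]eq_bigr do rewrite !mulrDr.
rewrite !big_split /= e2 e1 -!big_split /=; apply: eq_bigr => i _.
by rewrite /ctilde; ring.
Qed.

Lemma nonlinear_estimate :
  \sum_(0 <= i < k) mu`_i * (Phi i - Phi i.+1)
    - l / 2 * \sum_(0 <= i < k) ctilde Bh mu i * x i
  <= b (\sum_(1 <= i < k.+1) Bh`_i.-1 *: f i) (\sum_(0 <= i < k) mu`_i *: de i).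
Proof.
rewrite extrapolation_Abel (siDl hb) (si_sumr hb) (si_suml hb) sum_ctilde mulrDr.
have h1 : `|\sum_(0 <= j < k) mu`_j * (Phi j - Phi j.+1 - b (f 1) (de j))|
   <= l / 2 * \sum_(0 <= j < k) `|mu`_j|
        * (x j + (j != 0%N)%:R * x j + j%:R * \sum_(1 <= i < j.+1) x i).
  apply: le_trans (ler_norm_sum _ _ _) _; rewrite mulr_sumr; apply: ler_sum => j _.
  by rewrite normrM mulrCA ler_wpM2l // potential_increment.
have h2 : `|\sum_(1 <= i < k) bhat Bh i *
        b (f i - f i.+1) (\sum_(0 <= j < k) mu`_j *: de j)|
   <= l / 2 * \sum_(1 <= i < k) \sum_(0 <= j < k)
        `|bhat Bh i| * `|mu`_j| * (x i + x j).
  apply: le_trans (ler_norm_sum _ _ _) _; rewrite mulr_sumr; apply: ler_sum => i _.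
  rewrite (si_sumr hb) mulr_sumr; apply: le_trans (ler_norm_sum _ _ _) _.
  rewrite mulr_sumr; apply: ler_sum => j _.
  rewrite !normrM mulrA mulrCA ler_wpM2l ?mulr_ge0 //.
  exact: si_lipschitz.
have e1 : \sum_(0 <= j < k) mu`_j * (Phi j - Phi j.+1 - b (f 1) (de j))
  = \sum_(0 <= i < k) mu`_i * (Phi i - Phi i.+1)
    - \sum_(0 <= i < k) mu`_i * b (f 1) (de i).
  by rewrite -sumrB; apply: eq_bigr => i _; rewrite mulrBr.
rewrite e1 in h1; move: h1 h2; rewrite !ler_norml => /andP[_ h1] /andP[h2 _].
lra.
Qed.
End NonlinearEstimate.

Lemma hdot_semi_inner (R : realType) (W : hilbertType R) : semi_inner (hdot W).
Proof.
split=> [x y|a x y z|x].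
- by rewrite (hermC (hdot W)) expr0 mul1r.
- by rewrite linearDl linearZl_LR.
- by rewrite hdotE sqr_ge0.
Qed.

(** * The time-step restriction *)

Section Young.
Variable R : realType.

(** Young's inequality with exponents 1 / eta and 1 / (1 - eta), applied to the two
    terms on the right divided by eta and 1 - eta.  The bound on tau is the condition
    c zeta^2 <= P^eta Q^(1 - eta) solved for tau, with P and Q as in the proof.  For
    eta = 1 the inequality is direct. *)
Lemma weighted_Young (al be c ze et X Y Z tau : R) :
    0 < al -> 0 < be -> 0 < c -> 0 < ze -> 0 < et <= 1 -> 0 <= X -> 0 <= Y ->
    0 <= Z -> Z <= ze * X `^ et * Y `^ (1 - et) ->
    let etb := (1 - et) / et in
    0 < tau <= al * be `^ etb
      / (c `^ (1 + etb) * et * (1 - et) `^ etb * ze `^ (2 + 2 * etb)) ->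
  c * Z ^+ 2 <= al / tau * X ^+ 2 + be * Y ^+ 2.
Proof.
move=> al0 be0 c0 ze0 /andP[et0 et1] X0 Y0 Z0 ZXY etb /andP[tau0 tauM].
have [et_eq1|et_neq1] := eqVneq et 1.
  move: tauM ZXY; rewrite /etb et_eq1 subrr mul0r !powRr0 !addr0 mulr0 addr0 !mulr1.
  rewrite !powRr1 //; last exact: ltW.
  rewrite -[2]/(2%:R) powR_mulrn ?(ltW ze0) // => tauM ZX.
  have den0 : 0 < c * ze ^+ 2 by rewrite mulr_gt0 // exprn_gt0.
  have cz : c * ze ^+ 2 <= al / tau.
    by rewrite ler_pdivlMr // mulrC -ler_pdivlMr.
  apply: (@le_trans _ _ (c * (ze * X) ^+ 2)).
    by rewrite ler_pM2l // lerXn2r ?nnegrE // mulr_ge0 // ltW.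
  rewrite exprMn mulrA; apply: (@le_trans _ _ (al / tau * X ^+ 2)).
    by rewrite ler_wpM2r // sqr_ge0.
  by rewrite lerDl mulr_ge0 ?sqr_ge0 // ltW.
have et1' : 0 < 1 - et by rewrite subr_gt0 lt_neqAle et_neq1.
pose P := al / (tau * et); pose Q := be / (1 - et).
have P0 : 0 < P by rewrite divr_gt0 ?mulr_gt0.
have Q0 : 0 < Q by rewrite divr_gt0.
have etb_inv : 1 + etb = et^-1 by rewrite /etb; field; rewrite gt_eqF.
have step1 : (c * ze ^+ 2) `^ (1 + etb) <= P * Q `^ etb.
  rewrite powRM ?sqr_ge0 ?(ltW c0) // -powR_mulrn ?(ltW ze0) // -powRrM mulrDr mulr1.
  rewrite /Q -[be / _]/(be * _) powRM ?invr_ge0 ?(ltW be0) ?(ltW et1') //.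
  rewrite -powR_inv1 ?(ltW et1') // -powRrM mulN1r powRN /P.
  rewrite ler_pdivlMr in tauM; last by rewrite !mulr_gt0 ?powR_gt0.
  have d0 : 0 < (1 - et) `^ etb by rewrite powR_gt0.
  rewrite (_ : _ / _ * _ = (al * be `^ etb) / (tau * et * (1 - et) `^ etb));
    last by field; rewrite !gt_eqF.
  rewrite ler_pdivlMr ?mulr_gt0 //; apply: le_trans tauM.
  by rewrite le_eqVlt; apply/orP; left; apply/eqP; ring.
have step2 : c * ze ^+ 2 <= P `^ et * Q `^ (1 - et).
  have -> : c * ze ^+ 2 = ((c * ze ^+ 2) `^ (1 + etb)) `^ et.
    rewrite -powRrM etb_inv mulVf ?gt_eqF // powRr1 //.
    by rewrite mulr_ge0 ?sqr_ge0 // ltW.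
  have -> : P `^ et * Q `^ (1 - et) = (P * Q `^ etb) `^ et.
    rewrite powRM ?powR_ge0 ?(ltW P0) // -powRrM /etb divfK ?gt_eqF //.
  have PQ0 : 0 <= P * Q `^ etb by rewrite mulr_ge0 ?powR_ge0 // ltW.
  apply: ge0_ler_powR; rewrite ?nnegrE ?powR_ge0 //; exact: ltW.
have PX0 : 0 <= P * X ^+ 2 by rewrite mulr_ge0 ?sqr_ge0 // ltW.
have QY0 : 0 <= Q * Y ^+ 2 by rewrite mulr_ge0 ?sqr_ge0 // ltW.
have amgm : (P * X ^+ 2) `^ et * (Q * Y ^+ 2) `^ (1 - et)
    <= al / tau * X ^+ 2 + be * Y ^+ 2.
  have := @conjugate_powR R ((P * X ^+ 2) `^ et) ((Q * Y ^+ 2) `^ (1 - et))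
     et^-1 (1 - et)^-1 (powR_ge0 _ _) (powR_ge0 _ _).
  rewrite !invr_gt0 !invrK -!powRrM !divff ?gt_eqF // => /(_ et0 et1').
  rewrite !powRr1 // => H.
  apply: le_trans (H _) _; first by ring.
  rewrite le_eqVlt; apply/orP; left; apply/eqP; rewrite /P /Q.
  by field; rewrite !gt_eqF.
apply: le_trans amgm.
apply: (@le_trans _ _ (c * (ze * X `^ et * Y `^ (1 - et)) ^+ 2)).
  by rewrite ler_pM2l // lerXn2r ?nnegrE // !mulr_ge0 ?powR_ge0 // ltW.
have powR_sqr q x r : 0 <= q -> 0 <= x -> (q * x ^+ 2) `^ r = q `^ r * (x `^ r) ^+ 2.
  move=> q0 x0; rewrite powRM ?sqr_ge0 // -(powR_mulrn 2 x0) (powRAC x).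
  by rewrite powR_mulrn ?powR_ge0.
rewrite !powR_sqr ?(ltW P0) ?(ltW Q0) //.
rewrite (_ : c * _ = (c * ze ^+ 2) * (X `^ et ^+ 2 * Y `^ (1 - et) ^+ 2)); last by ring.
rewrite [leRHS](_ : _ = (P `^ et * Q `^ (1 - et)) * (X `^ et ^+ 2 * Y `^ (1 - et) ^+ 2)); last by ring.
by rewrite ler_wpM2r // mulr_ge0 ?sqr_ge0.
Qed.
End Young.

(** * The operators of the gradient flow *)

Section Flow.
Variables (R : realType) (d : nat) (D : flow_data R d).
Hypothesis hD : flow_axioms D.

Let hH := hdot_semi_inner (spH D).

Lemma to_dual_bounded (v : spH D) :
  exists K, forall w, `|to_dual v w| <= K * `|w|.
Proof.
have [_ jV_cont _] := jV_embedding hD.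
have /linear_boundedP jV_near : bounded_near (jV D) (nbhs (0 : spV D)).
  by apply/linear_bounded_continuous.
near (pinfty_nbhs R) => r.
have jV_r : forall w, `|jV D w| <= r * `|w| by near: r.
exists (`|v| * r) => w; rewrite -mulrA /to_dual /dotH.
apply: (@le_trans _ _ (`|v| * `|jV D w|)); last by rewrite ler_wpM2l.
rewrite -(ler_pXn2r (n := 2)) ?nnegrE ?mulr_ge0 // real_normK ?num_real //.
by rewrite exprMn -!hdotE si_CauchySchwarz.
Unshelve. all: by end_near. Qed.

Lemma to_dualP a (v w : spH D) :
  to_dual (a *: v + w) = a *: to_dual v + to_dual w.
Proof.
by apply/funext => x; rewrite /to_dual /dotH (siDl hH) (siZl hH).
Qed.

Lemma opM_semi_inner : semi_inner (fun v w : spV D => - opM D v w).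
Proof.
split=> [x y|a x y z|x]; first by rewrite (M_sym hD).
- rewrite linearP /= -[(_ + _) z]/(a * opM D x z + opM D y z); ring.
- have [c c0 hc] := M_coercive hD.
  by apply: le_trans (hc x); rewrite mulr_ge0 ?sqr_ge0 // ltW.
Qed.

Lemma opM_inj : injective (opM D).
Proof.
move=> x y exy; have [c c0 hc] := M_coercive hD.
have := hc (x - y); rewrite linearB /= exy subrr oppr0 => h.
have : `|x - y| ^+ 2 <= 0 by rewrite -(pmulr_rle0 _ c0).
by rewrite exprn_even_le0 //= normr_eq0 subr_eq0 => /eqP.
Qed.

(** The dual of V contains H through [to_dual], so that the operator M^{-1} of the
    modified energy is a true inverse on H. *)
Lemma opM_Minv v : opM D (Minv (to_dual v)) = to_dual v.
Proof.
suff [x xv] : exists x, opM D x = to_dual v.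
  by apply: (@xgetPex _ 0 [set y | opM D y = to_dual v]%classic); exists x.
have [K hK] := to_dual_bounded v.
have [C C0 hC] := M_bounded hD; have [c c0 hc] := M_coercive hD.
have [|||x xv] := @lax_milgram R (spV D) (fun x y => - opM D x y)
    (fun w => - to_dual v w) C c K opM_semi_inner c0 _ hc _ _.
- by move=> x y; rewrite normrN.
- by move=> a x y; rewrite /to_dual linearP /dotH (siDr hH) (siZr hH); ring.
- by move=> w; rewrite normrN.
by exists x; apply/funext => w; apply: oppr_inj.
Qed.

Lemma MinvHP a (v w : spH D) : MinvH (a *: v + w) = a *: MinvH v + MinvH w.
Proof.
rewrite /MinvH -linearP; congr (jV D _); apply: opM_inj.
by rewrite linearP !opM_Minv to_dualP.
Qed.

(** Writing v as M of something on the left as well turns the form into the one of -M,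
    evaluated at the preimages. *)
Lemma Minv_semi_inner : semi_inner (fun v w : spH D => dotH v (- MinvH w)).
Proof.
have E v w : dotH v (- MinvH w) = - opM D (Minv (to_dual v)) (Minv (to_dual w)).
  by rewrite opM_Minv /dotH (siNr hH).
split=> [x y|a x y z|x].
- by rewrite !E (M_sym hD).
- by rewrite /dotH (siDl hH) (siZl hH).
- by rewrite E; exact: (si_ge0 opM_semi_inner).
Qed.

Lemma jSHP a (u v : spS D) : jSH (a *: u + v) = a *: jSH u + jSH v.
Proof. by rewrite /jSH !linearP. Qed.

Lemma opL_semi_inner : semi_inner (fun u v : spS D => dotH (jSH u) (jV D (opL D v))).
Proof.
split=> [x y|a x y z|x].
- by rewrite -(L_sym hD) /dotH (siC hH).
- by rewrite jSHP /dotH (siDl hH) (siZl hH).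
- by rewrite -(L_sym hD) (L_ge0 hD).
Qed.

Lemma sqr_normMinv (v : spH D) : normMinv v ^+ 2 = dotH v (- MinvH v).
Proof. by rewrite sqr_sqrtr // (si_ge0 Minv_semi_inner). Qed.

Lemma sqr_normL (v : spS D) : normL v ^+ 2 = dotH (jSH v) (jV D (opL D v)).
Proof. by rewrite sqr_sqrtr (L_sym hD) // (si_ge0 opL_semi_inner). Qed.
End Flow.

(** * Dissipation of the modified energy *)

Lemma summation_by_parts (R : realType) (V : lmodType R) (a : nat -> R)
    (w : nat -> V) p :
  \sum_(0 <= i < p.+1) a i *: (w i - w i.+1)
  = a 0 *: w 0 + \sum_(1 <= i < p.+1) (a i - a i.-1) *: w i - a p *: w p.+1.
Proof.
elim: p => [|p IHp]; first by rewrite big_nat1 big_geq // addr0 scalerBr.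
rewrite big_nat_recr //= IHp [in RHS]big_nat_recr //= scalerBr scalerBl.
by rewrite -!addrA; congr (_ + (_ + _)); rewrite addrCA addrA.
Qed.

(** The weights satisfy chat_i - chat_{i+1} = ctilde_i and chat_k = 0, so one shift of the
    increments releases every ctilde_i x_i at the price of chat_0 x_0. *)
Lemma chat_telescope (R : realType) p (Bh mu : p.+1.-tuple R) (x : nat -> R) :
  \sum_(1 <= i < p.+1) chat Bh mu i * x i.-1
    - \sum_(1 <= i < p.+1) chat Bh mu i * x i
  = chat Bh mu 0 * x 0 - \sum_(0 <= i < p.+1) ctilde Bh mu i * x i.
Proof.
have -> : \sum_(0 <= i < p.+1) ctilde Bh mu i * x i
  = \sum_(0 <= i < p.+1) chat Bh mu i * x i
    - \sum_(0 <= i < p.+1) chat Bh mu i.+1 * x i.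
  rewrite -sumrB !big_nat; apply: eq_bigr => i /andP[_ ik].
  by rewrite /chat [X in _ = X * _ - _]big_ltn // [in RHS]mulrDl addrK.
have -> : \sum_(0 <= i < p.+1) chat Bh mu i.+1 * x i
  = \sum_(1 <= i < p.+1) chat Bh mu i * x i.-1.
  have chat_end : chat Bh mu p.+1 = 0 by rewrite /chat big_geq.
  rewrite big_nat_recr //= chat_end mul0r addr0.
  by rewrite [in RHS]big_add1.
rewrite [X in _ = _ - (X - _)]big_ltn //; ring.
Qed.

Section EnergyDecay.
Variables (R : realType) (d : nat) (D : flow_data R d).
Hypothesis hD : flow_axioms D.
Variables (p : nat) (A B : p.+2.-tuple R) (Bh mu : p.+1.-tuple R).
Local Notation k := p.+1.
Hypothesis sumA : \sum_(0 <= i < k.+1) A`_i = 0.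
Hypothesis sumBh : \sum_(1 <= i < k.+1) Bh`_i.-1 = 1.

Let hH := hdot_semi_inner (spH D).
Let hM := Minv_semi_inner hD.
Let hL := opL_semi_inner hD.

(** The a_i are the partial sums of the A_i; the last one is -A_k as the A_i sum to zero. *)
Lemma sum_avec (V : lmodType R) (w : nat -> V) :
  \sum_(i < k) (avec A)`_i *: (w i - w i.+1) = \sum_(0 <= i < k.+1) A`_i *: w i.
Proof.
pose a i := \sum_(0 <= j < i.+1) A`_j.
transitivity (\sum_(0 <= i < k) a i *: (w i - w i.+1)).
  by rewrite big_mkord; apply: eq_bigr => i _; rewrite nth_mktuple.
rewrite summation_by_parts [in RHS]big_ltn // [in RHS]big_nat_recr //= -!addrA.
congr (_ + (_ + _)); first by rewrite /a big_nat1.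
  rewrite !big_nat; apply: eq_bigr => -[|i] // _.
  have -> : a i.+1 = a i + A`_i.+1 by rewrite /a [in LHS]big_nat_recr.
  by rewrite addrAC subrr add0r.
rewrite -scaleNr; congr (_ *: _); apply: (@addrI _ (a p)).
by rewrite subrr -[LHS]sumA [in LHS]big_nat_recr.
Qed.

Lemma sum_nuvec (V : lmodType R) (w : nat -> V) :
  \sum_(i < k.+1) (nuvec mu)`_i *: w i = \sum_(0 <= i < k) mu`_i *: (w i - w i.+1).
Proof.
rewrite summation_by_parts.
transitivity (\sum_(0 <= i < k.+1) (if i == 0%N then mu`_0
    else if i == k then - mu`_k.-1 else mu`_i - mu`_i.-1) *: w i).
  by rewrite big_mkord; apply: eq_bigr => i _; rewrite nth_mktuple.
rewrite big_ltn // big_nat_recr //= eqxx -addrA scaleNr; congr (_ + (_ + _)).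
rewrite !big_nat; apply: eq_bigr => -[|i] // /andP[_ ik] /=.
by rewrite (ltn_eqF ik).
Qed.

Variables (Ga : 'M[R]_p) (GB : 'M[R]_k) (al be tau : R) (N : nat) (u : nat -> spS D).
Hypotheses (symGa : Ga^T = Ga) (symGB : GB^T = GB).
Hypothesis pdc : PDC A B mu Ga GB al be.
Hypotheses (al0 : 0 < al) (be0 : 0 < be).
Hypothesis scheme : imex_solution A B Bh tau N u.
Hypothesis tau_itv : 0 < tau <= tau_max D Bh mu al be.

Let tau0 : 0 < tau. Proof. by case/andP: tau_itv. Qed.

Lemma energyE n :
  energy Bh mu Ga GB tau u n
  = tau^-1 * \sum_(i < p) \sum_(j < p)
      Ga i j * dotH (delta u (n - i)) (- MinvH (delta u (n - j)))
    + \sum_(i < k) \sum_(j < k)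
        GB i j * dotH (jSH (u (n - i)%N)) (jV D (opL D (u (n - j)%N)))
    + \sum_(0 <= i < k) mu`_i * potential (u (n - i)%N)
    + ellf D / 2 * \sum_(1 <= i < k) chat Bh mu i
        * dotH (delta u (n.+1 - i)) (delta u (n.+1 - i)).
Proof.
rewrite /energy -mulrN; congr (_ * _ + _ + _ + _ * _).
  rewrite -sumrN; apply: eq_bigr => i _; rewrite -sumrN; apply: eq_bigr => j _.
  by rewrite /dotH (siNr hH) mulrN.
by apply: eq_bigr => i _; rewrite /dotH hdotE.
Qed.

Variable n : nat.
Hypothesis n_itv : (p <= n <= N.-1)%N.

Let w i := jSH (u (n.+1 - i)%N).
Let f i := jV D (nonlin (u (n.+1 - i)%N)).
Let de i := w i - w i.+1.
Let test := \sum_(0 <= i < k) mu`_i *: de i.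

Let deltaE i : delta u (n.+1 - i) = de i.
Proof. by rewrite /delta /de /w subnS. Qed.

(** The scheme is an identity in the dual of V.  It is moved to V by M^{-1} and tested
    there with the increments weighted by mu. *)
Lemma tested_scheme :
  tau^-1 * dotH (\sum_(i < k) mu`_i *: de i) (- MinvH (\sum_(i < k) (avec A)`_i *: de i))
  + dotH (jSH (\sum_(i < k.+1) (nuvec mu)`_i *: u (n.+1 - i)%N))
         (jV D (opL D (\sum_(i < k.+1) B`_i *: u (n.+1 - i)%N)))
  + dotH (\sum_(1 <= i < k.+1) Bh`_i.-1 *: f i) test = 0.
Proof.
have jSH_sum I (r : seq I) (c : I -> R) (v : I -> spS D) :
    jSH (\sum_(i <- r) c i *: v i) = \sum_(i <- r) c i *: jSH (v i).
  by rewrite /jSH !linear_sum; apply: eq_bigr => i _; rewrite !linearZ.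
have to_dual_sum I (r : seq I) (c : I -> R) (v : I -> spH D) :
    to_dual (\sum_(i <- r) c i *: v i) = \sum_(i <- r) c i *: to_dual (v i).
  elim: r => [|i r IHr]; last by rewrite !big_cons to_dualP // IHr.
  by rewrite !big_nil; apply/funext => x; rewrite /to_dual /dotH (si0l hH).
pose g := \sum_(0 <= i < k.+1) B`_i *: opL D (u (n.+1 - i)%N)
        + \sum_(1 <= i < k.+1) Bh`_i.-1 *: nonlin (u (n.+1 - i)%N).
have MinvZ : MinvH (\sum_(i < k) (avec A)`_i *: de i) = tau *: jV D g.
  rewrite /MinvH -linearZ; congr (jV D _); apply: (opM_inj hD).
  by rewrite opM_Minv // sum_avec to_dual_sum (scheme n_itv) linearZ.
have gE : jV D g = jV D (opL D (\sum_(i < k.+1) B`_i *: u (n.+1 - i)%N))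
            + \sum_(1 <= i < k.+1) Bh`_i.-1 *: f i.
  rewrite /g linearD !linear_sum big_mkord /=; congr (_ + _).
    by apply: eq_bigr => i _; rewrite !linearZ.
  by apply: eq_bigr => i _; rewrite linearZ.
have testE : \sum_(i < k) mu`_i *: de i = test by rewrite /test big_mkord.
rewrite MinvZ jSH_sum (sum_nuvec w) -/test testE gE /dotH.
rewrite (siNr hH) (siZr hH) (siDr hH) (siC hH _ test); field.
by rewrite gt_eqF.
Qed.

(** The interpolation inequality for the newest increment feeds [weighted_Young]; a
    nonpositive constant on the left needs neither. *)
Lemma increment_absorbed :
  ellf D * chat Bh mu 0 / 2 * dotH (de 0) (de 0)
  <= al / tau * dotH (de 0) (- MinvH (de 0))
     + be * dotH (jSH (u n.+1 - u n)) (jV D (opL D (u n.+1 - u n))).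
Proof.
have deE : de 0 = jSH (u n.+1 - u n).
  by rewrite /de /w subn0 subn1 /jSH -!linearB.
rewrite -sqr_normMinv // -sqr_normL //.
have rhs0 : 0 <= al / tau * normMinv (de 0) ^+ 2
    + be * normL (u n.+1 - u n) ^+ 2.
  by rewrite addr_ge0 // mulr_ge0 ?sqr_ge0 ?divr_ge0 // ltW.
have [c0|c0] := leP (ellf D * chat Bh mu 0 / 2) 0.
  by apply: le_trans rhs0; rewrite mulr_le0_ge0 // (si_ge0 hH).
rewrite /dotH hdotE; apply: (weighted_Young al0 be0 c0 (zeta_gt0 hD) (eta_itv hD)).
- exact: sqrtr_ge0.
- exact: sqrtr_ge0.
- exact: normr_ge0.
- by rewrite deE; exact: interpolation.
- exact: tau_itv.
Qed.

Lemma energy_decay :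
  energy Bh mu Ga GB tau u n.+1 <= energy Bh mu Ga GB tau u n.
Proof.
have [pdcA pdcB] := pdc.
(* Coefficients of the linear forms whose squares bound U_a and U_B from below. *)
pose cA (i : 'I_k) : R := (i == 0%N :> nat)%:R.
pose cB (i : 'I_k.+1) : R := (i == 0%N :> nat)%:R - (i == 1%N :> nat)%:R.
have cAE (V : lmodType R) (v : 'I_k -> V) : \sum_(i < k) cA i *: v i = v ord0.
  rewrite big_ord_recl big1 ?addr0 ?scale1r // => i _.
  by rewrite /cA /= scale0r.
have cBE (V : lmodType R) (v : nat -> V) :
    \sum_(i < k.+1) cB i *: v i = v 0 - v 1.
  rewrite !big_ord_recl big1 => [|i _].
    by rewrite /cB /= subr0 sub0r scale1r scaleN1r addr0.
  by rewrite /cB /= subr0 scale0r.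
have cAx (x : 'cV[R]_k) : \sum_(i < k) cA i * x i 0 = x ord0 0.
  exact: (cAE R^o (fun i => x i 0)).
have cBx (x : 'cV[R]_k.+1) :
    \sum_(i < k.+1) cB i * x i 0 = x ord0 0 - x (lift ord0 ord0) 0.
  rewrite !big_ord_recl big1 => [|i _]; last by rewrite /cB /= subr0 mul0r.
  by rewrite /cB /= subr0 sub0r mul1r mulN1r addr0.
have posA (x : 'cV[R]_k) : al * (\sum_(i < k) cA i * x i 0) ^+ 2 <= qform (Umx mu (avec A) Ga) x.
  by rewrite cAx; exact: pdcA.
have posB (x : 'cV[R]_k.+1) : be * (\sum_(i < k.+1) cB i * x i 0) ^+ 2 <= qform (Umx (nuvec mu) B GB) x.
  by rewrite cBx; exact: pdcB.
pose G1a := \sum_(i < p) \sum_(j < p) Ga i j * dotH (de i) (- MinvH (de j)).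
pose G0a := \sum_(i < p) \sum_(j < p) Ga i j * dotH (de i.+1) (- MinvH (de j.+1)).
pose G1b := \sum_(i < k) \sum_(j < k) GB i j
  * dotH (jSH (u (n.+1 - i)%N)) (jV D (opL D (u (n.+1 - j)%N))).
pose G0b := \sum_(i < k) \sum_(j < k) GB i j
  * dotH (jSH (u (n - i)%N)) (jV D (opL D (u (n - j)%N))).
have stabA : G1a + al * dotH (de 0) (- MinvH (de 0))
    <= G0a + dotH (\sum_(i < k) mu`_i *: de i)
         (- MinvH (\sum_(i < k) (avec A)`_i *: de i)).
  by have := G_stability de hM symGa posA; rewrite cAE.
have stabB : G1b + be * dotH (jSH (u n.+1 - u n)) (jV D (opL D (u n.+1 - u n)))
    <= G0b + dotH (jSH (\sum_(i < k.+1) (nuvec mu)`_i *: u (n.+1 - i)%N))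
         (jV D (opL D (\sum_(i < k.+1) B`_i *: u (n.+1 - i)%N))).
  have := G_stability (fun i => u (n.+1 - i)%N) hL symGB posB.
  by rewrite (cBE _ (fun i => u (n.+1 - i)%N)) subn0 subn1.
pose Phi i := potential (u (n.+1 - i)%N).
have lip i j : hdot (spH D) (f i - f j) (f i - f j)
    <= ellf D ^+ 2 * hdot (spH D) (w i - w j) (w i - w j).
  rewrite !hdotE -exprMn lerXn2r ?nnegrE ?mulr_ge0 ?(ltW (ellf_gt0 hD)) //.
  exact: f_lipschitz.
have quad i j : `|Phi i - Phi j - hdot (spH D) (f j) (w i - w j)|
    <= ellf D / 2 * hdot (spH D) (w i - w j) (w i - w j).
  by rewrite hdotE; exact: potential_quadratic.
have nonlin_le := nonlinear_estimate hH (ellf_gt0 hD) lip quad mu sumBh.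
rewrite !energyE.
have -> : \sum_(i < p) \sum_(j < p)
    Ga i j * dotH (delta u (n - i)) (- MinvH (delta u (n - j)))
  = \sum_(i < p) \sum_(j < p) Ga i j * dotH (de i.+1) (- MinvH (de j.+1)).
  by apply: eq_bigr => i _; apply: eq_bigr => j _; rewrite -2!deltaE !subSS.
have -> : \sum_(i < p) \sum_(j < p)
    Ga i j * dotH (delta u (n.+1 - i)) (- MinvH (delta u (n.+1 - j)))
  = \sum_(i < p) \sum_(j < p) Ga i j * dotH (de i) (- MinvH (de j)).
  by apply: eq_bigr => i _; apply: eq_bigr => j _; rewrite 2!deltaE.
have -> : \sum_(1 <= i < k) chat Bh mu i
    * dotH (delta u (n.+2 - i)) (delta u (n.+2 - i))
  = \sum_(1 <= i < k) chat Bh mu i * dotH (de i.-1) (de i.-1).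
  rewrite !big_nat; apply: eq_bigr => -[|i] // _.
  by rewrite subSS deltaE.
have -> : \sum_(1 <= i < k) chat Bh mu i
    * dotH (delta u (n.+1 - i)) (delta u (n.+1 - i))
  = \sum_(1 <= i < k) chat Bh mu i * dotH (de i) (de i).
  by apply: eq_bigr => i _; rewrite deltaE.
have tele := chat_telescope Bh mu (fun i => dotH (de i) (de i)).
have potE : \sum_(0 <= i < k) mu`_i * (Phi i - Phi i.+1)
  = \sum_(0 <= i < k) mu`_i * potential (u (n.+1 - i)%N)
    - \sum_(0 <= i < k) mu`_i * potential (u (n - i)%N).
  by rewrite -sumrB; apply: eq_bigr => i _; rewrite mulrBr /Phi subSS.
rewrite potE in nonlin_le.
rewrite -/G1a -/G0a -/G1b -/G0b.
pose S := \sum_(0 <= i < k) ctilde Bh mu i * dotH (de i) (de i).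
have {}nonlin_le : \sum_(0 <= i < k) mu`_i * potential (u (n.+1 - i)%N)
    - \sum_(0 <= i < k) mu`_i * potential (u (n - i)%N) - ellf D / 2 * S
  <= dotH (\sum_(1 <= i < k.+1) Bh`_i.-1 *: f i) test by exact: nonlin_le.
have absorbed := increment_absorbed; have tested := tested_scheme.
have inv_tau : 0 <= tau^-1 by rewrite invr_ge0 ltW.
have {}stabA := ler_wpM2l inv_tau stabA.
have {}tele := congr1 ( *%R (ellf D / 2)) tele; rewrite -/S in tele.
lra.
Qed.
End EnergyDecay.

(** * The coefficients of the IMEX-BDF6 scheme *)

Section BDF6.
Variable R : realType.

Definition bdf6_A : 7.-tuple R :=
  in_tuple [:: 49 / 20; - 6; 15 / 2; - (20 / 3); 15 / 4; - (6 / 5); 1 / 6].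
Definition bdf6_B : 7.-tuple R := in_tuple [:: 1; 0; 0; 0; 0; 0; 0].
Definition bdf6_Bh : 6.-tuple R := in_tuple [:: 6; - 15; 20; - 15; 6; - 1].
Definition bdf6_mu : 6.-tuple R :=
  in_tuple [:: 8 / 6; - 2 / 6; - 1 / 6; 3 / 6; - 3 / 6; 1 / 6].
Definition bdf6_Ga : 'M[R]_5 := 100^-1 *: \matrix_(i < 5, j < 5)
    (nth [::] [:: [:: 286; - 273; 229; - 125; 17];
                  [:: - 273; 354; - 279; 146; - 27];
                  [:: 229; - 279; 260; - 136; 25];
                  [:: - 125; 146; - 136; 87; - 15];
                  [:: 17; - 27; 25; - 15; 12]] i)`_j.
Definition bdf6_GB : 'M[R]_6 := 12^-1 *: \matrix_(i < 6, j < 6)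
    (nth [::] [:: [:: 13; - 6; 0; 4; - 5; 2];
                  [:: - 6; 7; - 4; 0; 2; - 1];
                  [:: 0; - 4; 6; - 4; 1; 0];
                  [:: 4; 0; - 4; 6; - 4; 1];
                  [:: - 5; 2; 1; - 4; 5; - 2];
                  [:: 2; - 1; 0; 1; - 2; 1]] i)`_j.

Lemma order_conditions_bdf6 : order_conditions bdf6_A bdf6_B bdf6_Bh.
Proof.
split; last 3 first.
- by rewrite !big_cons big_nil /=; lra.
- by rewrite !big_cons big_nil /=; lra.
- by rewrite !big_cons big_nil /=; lra.
- by rewrite !big_cons big_nil /=; lra.
move=> [|[|[|[|[|[|m]]]]]] // _.
all: rewrite !big_cons !big_nil /=; split; rewrite ?exprS ?expr0; lra.
Qed.

Lemma chat_bdf6 : chat bdf6_Bh bdf6_mu 0 = 625 / 3.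
Proof.
have bhatE : [/\ `|bhat bdf6_Bh 1| = 5, `|bhat bdf6_Bh 2| = 10, `|bhat bdf6_Bh 3| = 10,
    `|bhat bdf6_Bh 4| = 5 & `|bhat bdf6_Bh 5| = 1].
  by split; rewrite /bhat !big_cons big_nil /=;
    (rewrite ger0_norm; lra) || (rewrite ler0_norm; lra).
have muE : [/\ `|8 / 6| = 8 / 6 :> R, `|- 2 / 6| = 2 / 6 :> R,
    `|- 1 / 6| = 1 / 6 :> R, `|3 / 6| = 3 / 6 :> R & `|- 3 / 6| = 3 / 6 :> R].
  by split; (rewrite ger0_norm; lra) || (rewrite ler0_norm; lra).
have mu5 : `|1 / 6| = 1 / 6 :> R by rewrite ger0_norm; lra.
case: bhatE muE => b1 b2 b3 b4 b5 [m0 m1 m2 m3 m4].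
rewrite /chat /ctilde !big_cons !big_nil /= b1 b2 b3 b4 b5 m0 m1 m2 m3 m4 mu5.
lra.
Qed.

Lemma sum_bdf6_Ga (x : nat -> R) :
  \sum_(i < 5) \sum_(j < 5) bdf6_Ga i j * (x i * x j)
  = 100^-1 * (286 * x 0%N ^+ 2 - 546 * (x 0%N * x 1%N) + 458 * (x 0%N * x 2%N)
    - 250 * (x 0%N * x 3%N) + 34 * (x 0%N * x 4%N)
    + 354 * x 1%N ^+ 2 - 558 * (x 1%N * x 2%N) + 292 * (x 1%N * x 3%N) - 54 * (x 1%N * x 4%N)
    + 260 * x 2%N ^+ 2 - 272 * (x 2%N * x 3%N) + 50 * (x 2%N * x 4%N)
    + 87 * x 3%N ^+ 2 - 30 * (x 3%N * x 4%N) + 12 * x 4%N ^+ 2).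
Proof.
have bumpE i : bump 0 i = i.+1 by [].
by rewrite !big_ord_recl !big_ord0 !mxE /= !bumpE; ring.
Qed.

(** Up to sign, the last six squares are those of the tails of (-2, 1, 0, -1, 2, -1), read
    off along the variables from the first one on.  A form G of this kind is
    what the shift identity for U_B yields when the remainder is the rank-one square of
    (1, -2, 1, 0, -1, 2, -1); the first square accounts for beta. *)
Lemma sum_bdf6_GB (x : nat -> R) :
  \sum_(i < 6) \sum_(j < 6) bdf6_GB i j * (x i * x j)
  = 12^-1 * (2 * x 0%N ^+ 2 + x 0%N ^+ 2 + (2 * x 0%N - x 1%N) ^+ 2
      + (x 0%N - 2 * x 1%N + x 2%N) ^+ 2 + (x 1%N - 2 * x 2%N + x 3%N) ^+ 2
      + (x 0%N - x 2%N + 2 * x 3%N - x 4%N) ^+ 2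
      + (2 * x 0%N - x 1%N + x 3%N - 2 * x 4%N + x 5%N) ^+ 2).
Proof.
have bumpE i : bump 0 i = i.+1 by [].
by rewrite !big_ord_recl !big_ord0 !mxE /= !bumpE; ring.
Qed.

Lemma tr_bdf6_Ga : bdf6_Ga^T = bdf6_Ga.
Proof.
by apply/matrixP => i j; rewrite !mxE;
  case: i => -[|[|[|[|[|i]]]]] //= _; case: j => -[|[|[|[|[|j]]]]] //= _.
Qed.

Lemma tr_bdf6_GB : bdf6_GB^T = bdf6_GB.
Proof.
by apply/matrixP => i j; rewrite !mxE;
  case: i => -[|[|[|[|[|[|i]]]]]] //= _; case: j => -[|[|[|[|[|[|j]]]]]] //= _.
Qed.

(** Shifted sums are easier to state for vectors indexed by all natural numbers. *)
Lemma col_nat n (x : 'cV[R]_n.+1) : exists X : nat -> R, x = \col_i X i.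
Proof.
by exists (fun i => x (inord i) 0); apply/colP => i; rewrite mxE inord_val.
Qed.

Lemma qform_col n (G : 'M[R]_n) (x : nat -> R) :
  qform G (\col_i x i) = \sum_(i < n) \sum_(j < n) G i j * (x i * x j).
Proof.
by rewrite qformE; apply: eq_bigr => i _; apply: eq_bigr => j _; rewrite !mxE.
Qed.

Lemma qform_Umx m (s t : m.+1.-tuple R) (G : 'M[R]_m) (x : nat -> R) :
  qform (Umx s t G) (\col_i x i)
  = (\sum_(i < m.+1) s`_i * x i) * (\sum_(i < m.+1) t`_i * x i)
    - \sum_(i < m) \sum_(j < m) G i j * (x i * x j)
    + \sum_(i < m) \sum_(j < m) G i j * (x i.+1 * x j.+1).
Proof.
rewrite qform_col (sum_Umx s t G (K := fun i j => x i * x j)); last first.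
  by move=> i j; rewrite mulrC.
congr (_ - _ + _); rewrite mulr_suml; apply: eq_bigr => i _.
by rewrite mulr_sumr; apply: eq_bigr => j _; ring.
Qed.

Lemma posdef_bdf6_Ga : posdefmx bdf6_Ga.
Proof.
split; first exact: tr_bdf6_Ga.
move=> x; have [X ->] := col_nat x => x0; rewrite qform_col sum_bdf6_Ga.
set a := X 0%N; set b := X 1%N; set c := X 2%N; set d := X 3%N; set e := X 4%N.
have S0 : 0 < a ^+ 2 + b ^+ 2 + c ^+ 2 + d ^+ 2 + e ^+ 2.
  rewrite lt_def !addr_ge0 ?sqr_ge0 // andbT; apply: contraNneq x0.
  move/eqP; rewrite !paddr_eq0 ?addr_ge0 ?sqr_ge0 // !sqrf_eq0 -!andbA.
  case/and5P => /eqP a0 /eqP b0 /eqP c0 /eqP d0 /eqP e0.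
  by apply/eqP/colP => -[[|[|[|[|[|i]]]]] //= hi]; rewrite !mxE.
(* The three leading forms are rounded rows of a Cholesky factor of G_a minus a
   small multiple of the identity; what the rounding leaves is diagonally
   dominant, hence a sum of the remaining squares. *)
have sq (y : R) : 0 <= y ^+ 2 := sqr_ge0 y.
have := sq (32 * a - 31 * b + 26 * c - 14 * d + 2 * e).
have := sq (10 * b - 7 * c + 3 * d - e); have := sq (5 * c - 3 * d + e).
have := sq a; have := sq b; have := sq c; have := sq d; have := sq e.
have := sq (a - b); have := sq (a + c); have := sq (a - d); have := sq (a - e).
have := sq (b + c); have := sq (b + d); have := sq (b - e).
have := sq (c - d); have := sq (c - e); have := sq (d - e).
lra.
Qed.

(** The squares are in triangular position, so they vanish together only at zero. *)
Lemma posdef_bdf6_GB : posdefmx bdf6_GB.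
Proof.
split; first exact: tr_bdf6_GB.
move=> x; have [X ->] := col_nat x => x0; rewrite qform_col sum_bdf6_GB.
set a := X 0%N; set b := X 1%N; set c := X 2%N; set d := X 3%N; set e := X 4%N.
set f := X 5%N.
have h0 := sqr_ge0 a; have h1 := sqr_ge0 (2 * a - b).
have h2 := sqr_ge0 (a - 2 * b + c); have h3 := sqr_ge0 (b - 2 * c + d).
have h4 := sqr_ge0 (a - c + 2 * d - e).
have h5 := sqr_ge0 (2 * a - b + d - 2 * e + f).
have sq0 (y : R) : y ^+ 2 = 0 -> y = 0 by move=> /eqP; rewrite sqrf_eq0 => /eqP.
rewrite ltNge; apply: contra x0 => le0.
have a0 : a = 0 by apply: sq0; lra.
have b0 : 2 * a - b = 0 by apply: sq0; lra.
have c0 : a - 2 * b + c = 0 by apply: sq0; lra.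
have d0 : b - 2 * c + d = 0 by apply: sq0; lra.
have e0 : a - c + 2 * d - e = 0 by apply: sq0; lra.
have f0 : 2 * a - b + d - 2 * e + f = 0 by apply: sq0; lra.
have {}b0 : b = 0 by lra.
have {}c0 : c = 0 by lra.
have {}d0 : d = 0 by lra.
have {}e0 : e = 0 by lra.
have {}f0 : f = 0 by lra.
by apply/eqP/colP => -[[|[|[|[|[|[|i]]]]]] //= hi]; rewrite !mxE.
Qed.

Definition bdf6_a : 6.-tuple R :=
  in_tuple [:: 147 / 60; - 213 / 60; 237 / 60; - 163 / 60; 62 / 60; - 10 / 60].
Definition bdf6_nu : 7.-tuple R :=
  in_tuple [:: 8 / 6; - 10 / 6; 1 / 6; 4 / 6; - 6 / 6; 4 / 6; - 1 / 6].

Lemma avec_bdf6 : avec bdf6_A = bdf6_a.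
Proof.
apply/eq_from_tnth => i; rewrite tnth_mktuple (tnth_nth 0).
by case: i => -[|[|[|[|[|[|i]]]]]] // hi; rewrite !big_cons big_nil /=; field.
Qed.

Lemma nuvec_bdf6 : nuvec bdf6_mu = bdf6_nu.
Proof.
apply/eq_from_tnth => i; rewrite tnth_mktuple (tnth_nth 0).
by case: i => -[|[|[|[|[|[|[|i]]]]]]] // hi; rewrite /=; field.
Qed.

Lemma PDC_bdf6 : PDC bdf6_A bdf6_B bdf6_mu bdf6_Ga bdf6_GB (1 / 6) (1 / 6).
Proof.
have bumpE i : bump 0 i = i.+1 by [].
rewrite /PDC avec_bdf6 nuvec_bdf6.
split=> x; have [X ->] := col_nat x; rewrite qform_Umx !mxE.
  rewrite !sum_bdf6_Ga (sum_bdf6_Ga (fun i => X i.+1)).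
  rewrite !big_ord_recl !big_ord0 /= !bumpE.
  set a := X 0%N; set b := X 1%N; set c := X 2%N; set d := X 3%N; set e := X 4%N.
  set f := X 5%N.
  (* As for the positivity of G_a: rounded Cholesky rows of U_a - alpha e_1 e_1^T,
     then the squares that make up a diagonally dominant remainder. *)
  have sq (y : R) : 0 <= y ^+ 2 := sqr_ge0 y.
  have := sq (153 * a - 29 * b + 89 * c + 33 * d - 60 * e + 60 * f).
  have := sq (234 * b - 131 * c + 192 * d - 134 * e - 38 * f).
  have := sq (27 * c - 12 * d + 20 * e - 16 * f).
  have := sq (9 * d - 3 * e + 8 * f); have := sq (e - f).
  have := sq a; have := sq b; have := sq c.
  have := sq d; have := sq e; have := sq f.
  have := sq (a + b); have := sq (a + c); have := sq (a - d).
  have := sq (a - e); have := sq (a - f); have := sq (b - c).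
  have := sq (b + d); have := sq (b + e); have := sq (b - f).
  have := sq (c + d); have := sq (c - e); have := sq (c + f).
  have := sq (d + e); have := sq (d - f); have := sq (e + f).
  lra.
rewrite !sum_bdf6_GB (sum_bdf6_GB (fun i => X i.+1)).
rewrite !big_ord_recl !big_ord0 /= !bumpE.
(* The difference of the two sides is exactly one twelfth of this square. *)
have := sqr_ge0 (X 0%N - 2 * X 1%N + X 2%N - X 4%N + 2 * X 5%N - X 6%N).
lra.
Qed.
End BDF6.

(** * Generating polynomials and the feasibility conditions *)

Lemma dominant_constant_neq0 (C : numFieldType) n (c : nat -> C) (w : C) :
    `|w| <= 1 -> \sum_(i < n) `|c i.+1| < `|c 0%N| ->
  \sum_(i < n.+1) c i * w ^+ i != 0.
Proof.
move=> w1; apply: contraTneq; rewrite big_ord_recl /= expr0 mulr1.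
move=> /eqP; rewrite addr_eq0 => /eqP ->; rewrite normrN; apply/negP => lt_sum.
suff /(lt_le_trans lt_sum) : `|\sum_(i < n) c i.+1 * w ^+ i.+1|
  <= \sum_(i < n) `|c i.+1| by rewrite ltxx.
apply: le_trans (ler_norm_sum _ _ _) _; apply: ler_sum => i _.
by rewrite normrM normrX ler_piMr // exprn_ile1.
Qed.

Section GenPoly.
Variable R : realType.

Lemma size_genpoly r (s : r.+1.-tuple R) : s`_0 != 0 -> size (genpoly s) = r.+1.
Proof.
move=> s0; rewrite /genpoly big_ord_recl /= subn0 size_polyDl ?size_scale ?size_polyXn //.
rewrite ltnS (leq_trans (size_sum _ _ _)) //; apply/bigmax_leqP => i _.
by rewrite (leq_trans (size_scale_leq _ _)) // size_polyXn /= /bump leq0n add1n subnSK ?leq_subr.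
Qed.

Lemma horner_genpolyC r (s : r.-tuple R) (z : R[i]) :
  (genpolyC s).[z] = \sum_(i < r) (real_complex R s`_i) * z ^+ (r.-1 - i).
Proof.
rewrite /genpolyC /genpoly rmorph_sum horner_sum; apply: eq_bigr => i _.
by rewrite /= map_polyZ map_polyXn hornerZ hornerXn.
Qed.

(** De Moivre's formula. *)
Lemma expiX (t : R) n : expi t ^+ n = (cos (n%:R * t) +i* sin (n%:R * t))%C.
Proof.
elim: n => [|n IHn]; first by rewrite mul0r cos0 sin0.
rewrite exprSr IHn -natr1 mulrDl mul1r cosD sinD /expi.
by apply/eqP; rewrite eq_complex /= eqxx /= addrC.
Qed.

Lemma horner_genpoly_expi r (s : r.-tuple R) (t : R) :
  (genpolyC s).[expi t]
  = ((\sum_(i < r) s`_i * cos ((r.-1 - i)%:R * t))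
     +i* (\sum_(i < r) s`_i * sin ((r.-1 - i)%:R * t)))%C.
Proof.
rewrite horner_genpolyC; elim: (index_enum _) => [|i e IHe].
  by rewrite !big_nil.
rewrite !big_cons IHe expiX; apply/eqP.
by rewrite eq_complex /= !mul0r subr0 addr0 !eqxx.
Qed.

Lemma Re_genpoly_product r (s q : r.-tuple R) (t : R) :
  complex.Re ((genpolyC s).[expi t] * (genpolyC q).[expi (- t)])
  = (\sum_(i < r) s`_i * cos ((r.-1 - i)%:R * t))
      * (\sum_(i < r) q`_i * cos ((r.-1 - i)%:R * t))
    + (\sum_(i < r) s`_i * sin ((r.-1 - i)%:R * t))
      * (\sum_(i < r) q`_i * sin ((r.-1 - i)%:R * t)).
Proof.
have cos_even : \sum_(i < r) q`_i * cos ((r.-1 - i)%:R * - t)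
    = \sum_(i < r) q`_i * cos ((r.-1 - i)%:R * t).
  by apply: eq_bigr => i _; rewrite mulrN cosN.
have sin_odd : \sum_(i < r) q`_i * sin ((r.-1 - i)%:R * - t)
    = - \sum_(i < r) q`_i * sin ((r.-1 - i)%:R * t).
  by rewrite -sumrN; apply: eq_bigr => i _; rewrite mulrN sinN mulrN.
by rewrite !horner_genpoly_expi /= cos_even sin_odd mulrN opprK.
Qed.

(** Chebyshev polynomials of both kinds up to degree six.  The sine is kept as a
    factor, so that products of two sines are polynomials in the cosine. *)
Lemma multiple_angles (t : R) (c := cos t) (s := sin t) :
  [/\ cos (2 * t) = 2 * c ^+ 2 - 1 /\ sin (2 * t) = s * (2 * c),
      cos (3 * t) = 4 * c ^+ 3 - 3 * c /\ sin (3 * t) = s * (4 * c ^+ 2 - 1),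
      cos (4 * t) = 8 * c ^+ 4 - 8 * c ^+ 2 + 1 /\
      sin (4 * t) = s * (8 * c ^+ 3 - 4 * c),
      cos (5 * t) = 16 * c ^+ 5 - 20 * c ^+ 3 + 5 * c /\
      sin (5 * t) = s * (16 * c ^+ 4 - 12 * c ^+ 2 + 1)
    & cos (6 * t) = 32 * c ^+ 6 - 48 * c ^+ 4 + 18 * c ^+ 2 - 1 /\
      sin (6 * t) = s * (32 * c ^+ 5 - 32 * c ^+ 3 + 6 * c)].
Proof.
have ss : s ^+ 2 = 1 - c ^+ 2 by exact: sin2cos2.
have step (n : R) : cos ((n + 1) * t) = cos (n * t) * c - sin (n * t) * s /\
    sin ((n + 1) * t) = sin (n * t) * c + cos (n * t) * s.
  by rewrite mulrDl mul1r cosD sinD.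
have [] := step 1; rewrite mul1r (_ : 1 + 1 = 2) // => c2 s2.
have {}c2 : cos (2 * t) = 2 * c ^+ 2 - 1 by rewrite c2 -/c -/s; ring: ss.
have {}s2 : sin (2 * t) = s * (2 * c) by rewrite s2 -/c -/s; ring.
have [] := step 2; rewrite (_ : 2 + 1 = 3) ?natr1 // c2 s2 => c3 s3.
have {}c3 : cos (3 * t) = 4 * c ^+ 3 - 3 * c by rewrite c3; ring: ss.
have {}s3 : sin (3 * t) = s * (4 * c ^+ 2 - 1) by rewrite s3; ring.
have [] := step 3; rewrite (_ : 3 + 1 = 4) ?natr1 // c3 s3 => c4 s4.
have {}c4 : cos (4 * t) = 8 * c ^+ 4 - 8 * c ^+ 2 + 1 by rewrite c4; ring: ss.
have {}s4 : sin (4 * t) = s * (8 * c ^+ 3 - 4 * c) by rewrite s4; ring.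
have [] := step 4; rewrite (_ : 4 + 1 = 5) ?natr1 // c4 s4 => c5 s5.
have {}c5 : cos (5 * t) = 16 * c ^+ 5 - 20 * c ^+ 3 + 5 * c by rewrite c5; ring: ss.
have {}s5 : sin (5 * t) = s * (16 * c ^+ 4 - 12 * c ^+ 2 + 1) by rewrite s5; ring.
have [] := step 5; rewrite (_ : 5 + 1 = 6) ?natr1 // c5 s5 => c6 s6.
have {}c6 : cos (6 * t) = 32 * c ^+ 6 - 48 * c ^+ 4 + 18 * c ^+ 2 - 1.
  by rewrite c6; ring: ss.
have {}s6 : sin (6 * t) = s * (32 * c ^+ 5 - 32 * c ^+ 3 + 6 * c) by rewrite s6; ring.
by [].
Qed.

Lemma horner_bdf6_mu (z : R[i]) : 6 * (genpolyC (bdf6_mu R)).[z]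
  = 8 * z ^+ 5 - 2 * z ^+ 4 - z ^+ 3 + 3 * z ^+ 2 - 3 * z + 1.
Proof.
have bumpE i : bump 0 i = i.+1 by [].
rewrite horner_genpolyC !big_ord_recl big_ord0 /= !bumpE ?subSS ?subn0.
by rewrite !(rmorphM, rmorphN, fmorphV, rmorph_nat, rmorph1) /=; field.
Qed.

Lemma horner_bdf6_a (z : R[i]) : 60 * (genpolyC (bdf6_a R)).[z]
  = 147 * z ^+ 5 - 213 * z ^+ 4 + 237 * z ^+ 3 - 163 * z ^+ 2 + 62 * z - 10.
Proof.
have bumpE i : bump 0 i = i.+1 by [].
rewrite horner_genpolyC !big_ord_recl big_ord0 /= !bumpE ?subSS ?subn0.
by rewrite !(rmorphM, rmorphN, fmorphV, rmorph_nat, rmorph1) /=; field.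
Qed.

(** Multiplying by 4 z + 1 removes the second highest coefficient and makes the leading
    one dominant: the product is 32 z^6 - 6 z^4 + 11 z^3 - 9 z^2 + z + 1, and 32 > 28.  In
    the variable 1 / z the leading coefficient is the constant one. *)
Lemma root_bdf6_mu (z : R[i]) : root (genpolyC (bdf6_mu R)) z -> `|z| < 1.
Proof.
move/rootP => mu_z; have := horner_bdf6_mu z; rewrite mu_z mulr0 => /esym {}mu_z.
rewrite real_ltNge ?num_real ?normr_real //; apply/negP => z1.
have z0 : z != 0 by rewrite -normr_gt0 (lt_le_trans ltr01).
have := @dominant_constant_neq0 _ 6 (nth 0 [:: 32; 0; - 6; 11; - 9; 1; 1]) z^-1.
rewrite normfV invf_le1 ?normr_gt0 // => /(_ z1).
rewrite !big_ord_recl !big_ord0 /= !normrN normr0 !normr_nat normr1.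
rewrite [X in X < _](_ : _ = 28%:R); last by ring.
rewrite ltr_nat => /(_ isT) /eqP; apply.
transitivity (z ^- 6 * ((4 * z + 1) * (8 * z ^+ 5 - 2 * z ^+ 4 - z ^+ 3
  + 3 * z ^+ 2 - 3 * z + 1))); last by rewrite mu_z !mulr0.
by rewrite /bump /=; field.
Qed.

(** A common root would lie in the unit disk by [root_bdf6_mu] and be a root of every
    polynomial combination.  The multipliers come from lattice reduction of the
    multiples of the two polynomials; they give
    26 - z + 3 z^2 + 5 z^3 - 3 z^4 - 4 z^5 - 4 z^6 + 2 z^9, and 26 > 22.  The exact
    Bezout identity would involve integers of about ten digits. *)
Lemma coprime_bdf6_a_mu : coprimep (genpoly (bdf6_a R)) (genpoly (bdf6_mu R)).
Proof.
rewrite -(coprimep_map (real_complex R)).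
apply/Pdiv.ClosedField.root_coprimep => z /rootP a_z.
apply/negP => mu_root; have z1 := ltW (root_bdf6_mu mu_root).
move/rootP: mu_root => mu_z.
have := horner_bdf6_a z; rewrite /genpolyC a_z mulr0 => {}a_z.
have := horner_bdf6_mu z; rewrite mu_z mulr0 => {}mu_z.
have := @dominant_constant_neq0 _ 9 (nth 0 [:: 26; - 1; 3; 5; - 3; - 4; - 4; 0; 0; 2]) z z1.
rewrite !big_ord_recl !big_ord0 /= !normrN !normr0 !normr_nat normr1.
rewrite [X in X < _](_ : _ = 22%:R); last by ring.
rewrite ltr_nat => /(_ isT) /eqP; apply.
transitivity ((12 - 27 * z - 6 * z ^+ 2 - 30 * z ^+ 3 - 74 * z ^+ 4)
    * (147 * z ^+ 5 - 213 * z ^+ 4 + 237 * z ^+ 3 - 163 * z ^+ 2 + 62 * z - 10)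
  + (146 - 577 * z + 1404 * z ^+ 2 - 1079 * z ^+ 3 + 1360 * z ^+ 4)
    * (8 * z ^+ 5 - 2 * z ^+ 4 - z ^+ 3 + 3 * z ^+ 2 - 3 * z + 1)).
  by rewrite /bump /=; ring.
by rewrite -a_z -mu_z !mulr0 addr0.
Qed.

(** M(z; B) is z^6, whose only root is not one of M(z; nu), since nu_6 is nonzero. *)
Lemma coprime_bdf6_B_nu : coprimep (genpoly (bdf6_B R)) (genpoly (bdf6_nu R)).
Proof.
have -> : genpoly (bdf6_B R) = ('X - 0%:P) ^+ 6.
  by rewrite /genpoly !big_ord_recl big_ord0 /= !scale0r !addr0 scale1r subr0.
rewrite coprimep_expl // coprimep_sym coprimep_XsubC; apply/negP => /rootP.
rewrite /genpoly horner_sum !big_ord_recl big_ord0 /= !hornerZ !hornerXn !expr0n /=.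
by rewrite !mulr0 !add0r addr0 mulr1 => h; lra.
Qed.

Definition bdf6_Pa : {poly R} :=
  Poly [:: 72 / 360; 20 / 360; 2044 / 360; - 1744 / 360; - 1104 / 360; 1072 / 360].
(** This is 1/6 + (8/3) x^2 (1 - x)^2 (1 + x), expanded. *)
Definition bdf6_PB : {poly R} :=
  Poly [:: 1 / 6; 0; 8 / 3; - 8 / 3; - 8 / 3; 8 / 3].

Lemma bdf6_Pa_cos (t : R) : bdf6_Pa.[cos t]
  = complex.Re ((genpolyC (bdf6_a R)).[expi t] * (genpolyC (bdf6_mu R)).[expi (- t)]).
Proof.
have ss : sin t ^+ 2 = 1 - cos t ^+ 2 by exact: sin2cos2.
have bumpE i : bump 0 i = i.+1 by [].
have [[c2 s2] [c3 s3] [c4 s4] [c5 s5] _] := multiple_angles t.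
rewrite Re_genpoly_product horner_Poly !big_ord_recl !big_ord0 /= !bumpE ?subSS ?subn0.
rewrite c2 s2 c3 s3 c4 s4 c5 s5 !mulr0n !mul0r ?mulr1n !mul1r cos0 sin0.
by field: ss.
Qed.

Lemma bdf6_PB_cos (t : R) : 0 < t <= pi -> bdf6_PB.[cos t]
  = complex.Re ((genpolyC (bdf6_B R)).[expi t] * (genpolyC (bdf6_nu R)).[expi (- t)])
    / (2 * (1 - cos t)).
Proof.
move=> /andP[t0 tpi]; have ss : sin t ^+ 2 = 1 - cos t ^+ 2 by exact: sin2cos2.
have c1 : 0 < 1 - cos t.
  rewrite subr_gt0 -cos0 ltr_cos ?in_itv /= ?lexx ?pi_ge0 //.
  by rewrite (ltW t0).
have bumpE i : bump 0 i = i.+1 by [].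
have [[c2 s2] [c3 s3] [c4 s4] [c5 s5] [c6 s6]] := multiple_angles t.
have c2_neq0 : 2 * (1 - cos t) != 0 by rewrite gt_eqF // mulr_gt0.
apply: (mulIf c2_neq0); rewrite divfK //.
rewrite Re_genpoly_product horner_Poly !big_ord_recl !big_ord0 /= !bumpE ?subSS ?subn0.
rewrite c2 s2 c3 s3 c4 s4 c5 s5 c6 s6 !mulr0n !mul0r ?mulr1n !mul1r cos0 sin0.
by field: ss.
Qed.

Lemma bdf6_Pa_ge x : -1 <= x <= 1 -> 1 / 6 <= bdf6_Pa.[x].
Proof.
move=> /andP[x0 x1]; rewrite horner_Poly /=.
(* 360 (P_a - 1/6) is 12 + 20 x + 9 x^2 plus x^2 times this cubic; the quadratic
   has negative discriminant. *)
have h1 : 0 <= x ^+ 2 * (2035 - 1744 * x - 1104 * x ^+ 2 + 1072 * x ^+ 3).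
  have -> : 2035 - 1744 * x - 1104 * x ^+ 2 + 1072 * x ^+ 3
    = 259 + 672 * (1 - x) + 32 * ((1 - x) * (1 + x))
      + 1072 * ((1 - x) ^+ 2 * (1 + x)) by ring.
  apply: mulr_ge0; first exact: sqr_ge0.
  have : 0 <= (1 - x) ^+ 2 * (1 + x) by apply: mulr_ge0; [exact: sqr_ge0|lra].
  have : 0 <= (1 - x) * (1 + x) by apply: mulr_ge0; lra.
  lra.
have h2 := sqr_ge0 (3 * x + 10 / 3).
move: h1 h2; lra.
Qed.

Lemma bdf6_PB_ge x : -1 <= x <= 1 -> 1 / 6 <= bdf6_PB.[x].
Proof.
move=> /andP[x0 x1]; rewrite horner_Poly /=.
(* P_B - 1/6; it comes from |l(z)|^2 / 12 with l(z) = (z - 1)^2 (z^4 - 1). *)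
have : 0 <= 8 / 3 * x ^+ 2 * ((1 - x) ^+ 2 * (1 + x)).
  by do 2?apply: mulr_ge0; rewrite ?sqr_ge0; lra.
lra.
Qed.

Lemma FP_bdf6 : FP (bdf6_A R) (bdf6_B R) (bdf6_mu R) (1 / 6) (1 / 6).
Proof.
rewrite /FP avec_bdf6 nuvec_bdf6; split.
- by split; lra.
- by rewrite !big_cons !big_nil /=; split; lra.
- by split; apply: size_genpoly => /=; rewrite gt_eqF //; lra.
- by split; [exact: root_bdf6_mu | split; [exact: coprime_bdf6_a_mu|exact: coprime_bdf6_B_nu]].
exists bdf6_Pa, bdf6_PB; split => [t _|t|x x1]; [exact: bdf6_Pa_cos|exact: bdf6_PB_cos|].
by split; [exact: bdf6_Pa_ge|exact: bdf6_PB_ge].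
Qed.
End GenPoly.

Theorem proposition4p1 (R : realType) :
  let A : 7.-tuple R :=
    in_tuple [:: 49 / 20; - 6; 15 / 2; - (20 / 3); 15 / 4; - (6 / 5); 1 / 6] in
  let B : 7.-tuple R := in_tuple [:: 1; 0; 0; 0; 0; 0; 0] in
  let Bh : 6.-tuple R := in_tuple [:: 6; - 15; 20; - 15; 6; - 1] in
  let mu : 6.-tuple R :=
    in_tuple [:: 8 / 6; - 2 / 6; - 1 / 6; 3 / 6; - 3 / 6; 1 / 6] in
  let Ga : 'M[R]_5 := 100^-1 *: \matrix_(i < 5, j < 5)
    (nth [::] [:: [:: 286; - 273; 229; - 125; 17];
                  [:: - 273; 354; - 279; 146; - 27];
                  [:: 229; - 279; 260; - 136; 25];
                  [:: - 125; 146; - 136; 87; - 15];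
                  [:: 17; - 27; 25; - 15; 12]] i)`_j in
  let GB : 'M[R]_6 := 12^-1 *: \matrix_(i < 6, j < 6)
    (nth [::] [:: [:: 13; - 6; 0; 4; - 5; 2];
                  [:: - 6; 7; - 4; 0; 2; - 1];
                  [:: 0; - 4; 6; - 4; 1; 0];
                  [:: 4; 0; - 4; 6; - 4; 1];
                  [:: - 5; 2; 1; - 4; 5; - 2];
                  [:: 2; - 1; 0; 1; - 2; 1]] i)`_j in
  let alpha : R := 1 / 6 in
  let beta : R := 1 / 6 in
  [/\ order_conditions A B Bh /\ FP A B mu alpha beta,
      (forall (d : nat) (hd : (1 <= d <= 3)%N) (D : flow_data R d)
              (hD : flow_axioms D) (T tau : R) (N : nat) (u : nat -> spS D),
         0 < T -> (0 < N)%N -> tau = T / N%:R ->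
         imex_solution A B Bh tau N u ->
         0 < tau <= tau_max D Bh mu alpha beta ->
         forall n : nat, (5 <= n <= N.-1)%N ->
           energy Bh mu Ga GB tau u n.+1 <= energy Bh mu Ga GB tau u n),
      posdefmx Ga /\ posdefmx GB,
      PDC A B mu Ga GB alpha beta
    & chat Bh mu 0 = 625 / 3].
Proof.
move=> A B Bh mu Ga GB alpha beta; split.
- by split; [exact: order_conditions_bdf6 | exact: FP_bdf6].
- move=> d _ D hD T tau N u _ _ _ scheme tau_itv n n_itv.
  apply: (energy_decay hD _ _ (tr_bdf6_Ga R) (tr_bdf6_GB R) (PDC_bdf6 R) _ _ scheme tau_itv n_itv).
  + by case: (order_conditions_bdf6 R).
  + by case: (order_conditions_bdf6 R).
  + by rewrite /alpha; lra.
  + by rewrite /beta; lra.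
- by split; [exact: posdef_bdf6_Ga | exact: posdef_bdf6_GB].
- exact: PDC_bdf6.
- exact: chat_bdf6.
Qed.
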